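(* Let $X$ be a locally compact Hausdorff space and let $\tau=(\tau_1,\tau_2,\dots,\tau_n)$ be a collection of continuous self maps of $X$. Then $C_0(X)\times_{\tau}\mathbb{F}_n^+$ is completely isometrically isomorphic to $*_{C_0(X)}\left(C_0(X)\times_{\tau_i}\mathbb{Z}^+\right)$.
   Context: Operator algebras are (not necessarily selfadjoint) norm-closed algebras of operators on Hilbert space. Semicrossed product: $C_0(X)\times_\tau\mathbb{F}_n^+$ is the universal (nonselfadjoint) operator algebra generated by $C_0(X)$ and contractions $S_1,\dots,S_n$ satisfying the covariance relations $fS_i=S_i(f\circ\tau_i)$ for all $f\in C_0(X)$ and all $i$. Here $\mathbb{F}_n^+$ is the free semigroup generated by $n$ copies of $\mathbb{Z}^+$ amalgamated over the identity. Precisely: a covariant representation is a nondegenerate $*$-representation $\rho:C_0(X)\to B(\mathcal H)$ together with contractions $T_1,\dots,T_n\in B(\mathcal H)$ such that $\rho(f)T_i\rho(g)=T_i\rho((f\circ\tau_i)g)$ for all $f,g\in C_0(X)$ and all $i$; the semicrossed product is the operator algebra generated by elements $f$ and $S_if$ ($f\in C_0(X)$, $1\le i\le n$), with matrix norms given by the supremum over all covariant representations (where $f\mapsto\rho(f)$, $S_if\mapsto T_i\rho(f)$). When $X$ is compact the $S_i$ themselves belong to the algebra. When $n=1$, with a single continuous map $\tau_i$, this algebra is denoted $C_0(X)\times_{\tau_i}\mathbb{Z}^+$. Free product: for operator algebras $A_i$ sharing a common $C^*$-subalgebra $D$, $*_D A_i$ is the universal operator algebra free product with amalgamation over $D$,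 i.e. the operator algebra generated by completely isometric copies $\iota_i(A_i)$ (with the completely isometric homomorphisms $\iota_i$ agreeing on $D$) such that whenever $\pi_i:A_i\to S$ are completely contractive homomorphisms into an operator algebra $S$ with $\pi_i(x)=\pi_j(x)$ for all $x\in D$ and all $i,j$, there is a unique completely contractive homomorphism $*\pi_i:*_D A_i\to S$ with $( *\pi_i)\circ\iota_i=\pi_i$ for all $i$. *)

(* Defs.v *)
From HB Require Import structures.
From mathcomp Require Import all_boot all_order all_algebra.
From mathcomp Require Import all_classical all_reals all_analysis.
From mathcomp Require Import complex.

Set Implicit Arguments.
Unset Strict Implicit.
Unset Printing Implicit Defensive.

Import Order.TTheory GRing.Theory Num.Theory.
Import numFieldTopology.Exports numFieldNormedType.Exports.

Local Open Scope classical_set_scope.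
Local Open Scope ring_scope.

(* MathComp-Analysis topologises an abstract numClosedFieldType by its norm;
   naming R[i] as one makes that topology available on the complex numbers. *)
Definition cplx (R : realType) : numClosedFieldType := (R[i])%C.

Section C0.
Variables (R : realType) (X : topologicalType).
Local Notation C := (cplx R).

Definition vanishes_at_infinity (f : X -> C) :=
  forall e : C, 0 < e -> compact [set x | e <= `|f x|].

Definition C0_pred : {pred (X -> C)} :=
  fun f => `[< continuous f /\ vanishes_at_infinity f >].

Lemma C0P f : reflect (continuous f /\ vanishes_at_infinity f) (f \in C0_pred).
Proof. exact: asboolP. Qed.

Lemma norm_level_closed (f : X -> C) (e : C) :
  continuous f -> e \is Num.real -> closed [set x | e <= `|f x|].
Proof.
move=> fc er; rewrite -[X in closed X]setCK; apply: open_closedC.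
rewrite openE => x /=.
move/negP; rewrite -real_ltNge ?normr_real// => fxe.
have d0 : 0 < e - `|f x| by rewrite subr_gt0.
have := fc x; move/cvgrPdist_lt => /(_ _ d0); apply: filterS => y /= fxy.
apply/negP; rewrite -real_ltNge ?normr_real//.
rewrite -(subrK (f x) (f y)) (le_lt_trans (ler_normD _ _))//.
by rewrite -ltrBrDr distrC.
Qed.

Lemma C0_domin (f : X -> C) (g : X -> C) :
  continuous f -> g \in C0_pred ->
  (exists2 M : C, 0 < M & forall x, `|f x| <= M * `|g x|) -> f \in C0_pred.
Proof.
move=> fc /C0P[gc g0] [M M0 fg]; apply/C0P; split=> // e e0.
apply: (subclosed_compact (norm_level_closed fc (gtr0_real e0))
  (g0 _ (divr_gt0 e0 M0))) => x /= efx.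
by rewrite ler_pdivrMr// mulrC (le_trans efx).
Qed.

Lemma C0_bounded (f : X -> C) : f \in C0_pred ->
  exists2 M : C, 0 < M & forall x, `|f x| <= M.
Proof.
move=> /C0P[fc /(_ 1 ltr01)]; rewrite compact_near_coveringP => cK.
have := cK C (pinfty_nbhs C) (fun M x => `|f x| <= M) _ => /(_ _)[|M [Mr KM]].
  move=> x _; have := fc x; move/cvgrPdist_lt => /(_ _ ltr01) fx.
  exists ([set y | `|f x - f y| < 1], [set M | `|f x| + 1 < M]) => /=.
    by split=> //; exists (`|f x| + 1); split=> //; rewrite ?realD ?normr_real.
  move=> [y M] /= [fxy fxM]; apply: ltW; apply: le_lt_trans fxM.
  rewrite -(subrK (f x) (f y)) (le_trans (ler_normD _ _))//.
  by rewrite addrC lerD2l distrC ltW.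
pose N := `|M| + 1 + 1.
have N0 : 1 < N by rewrite /N ltrDr ltr_wpDl.
exists N => [|x]; first exact: lt_trans ltr01 N0.
have [fx|] := boolP (1 <= `|f x|); last first.
  by rewrite -real_ltNge ?normr_real// => /ltW/le_trans; apply; exact: ltW.
apply: KM (fx); rewrite /N -addrA ltr_pwDr//.
by rewrite real_ler_norm.
Qed.

Lemma C0_submod : GRing.submod_closed C0_pred.
Proof.
split=> [|a f g f0 g0].
  apply/C0P; split=> [x|e e0]; first exact: cst_continuous.
  rewrite [X in compact X](_ : _ = set0); first exact: compact0.
  by rewrite -subset0 => x /=; rewrite normr0 lt_geF.
have /C0P[fc fv] := f0; have /C0P[gc gv] := g0.
have hc : continuous (a *: f + g).
  by move=> x; exact: (cvgD (cvgZl_tmp (k := a) (fc x)) (gc x)).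
apply/C0P; split => // e e0.
have a0 : 0 < `|a| + 1 by rewrite ltr_wpDl.
have d0 : 0 < e / 2 / (`|a| + 1) by rewrite !divr_gt0.
have d1 : 0 < e / 2 by rewrite divr_gt0.
apply: (subclosed_compact (norm_level_closed hc (gtr0_real e0))
  (compactU (fv _ d0) (gv _ d1))) => x /= ex.
have [fx|] := boolP (e / 2 / (`|a| + 1) <= `|f x|); first by left.
have [gx|] := boolP (e / 2 <= `|g x|); first by right.
rewrite -!real_ltNge ?normr_real ?gtr0_real// => gx fx.
suff /lt_geF : `|(a *: f + g) x| < e by rewrite ex.
rewrite (le_lt_trans (ler_normD _ _))// [ltRHS]splitr ler_ltD//.
rewrite normrZ (le_trans (_ : _ <= (`|a| + 1) * `|f x|))//.
  by rewrite ler_wpM2r// lerDl.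
by rewrite mulrC -ler_pdivlMr// ltW.
Qed.
HB.instance Definition _ := GRing.isSubmodClosed.Build C (X -> C) C0_pred C0_submod.

Record C0 := MkC0 { C0_val :> X -> C ; _ : C0_val \in C0_pred }.
HB.instance Definition _ := [isSub for C0_val].
HB.instance Definition _ := [Choice of C0 by <:].
HB.instance Definition _ := [SubChoice_isSubLmodule of C0 by <:].

Lemma C0_valP (f : C0) : C0_val f \in C0_pred. Proof. by case: f. Qed.

Lemma C0_pull_subproof (t : continuousType X X) (f g : C0) :
  (fun x => f (t x) * g x) \in C0_pred.
Proof.
have [M M0 fM] := C0_bounded (C0_valP f).
have /C0P[fc _] := C0_valP f; have /C0P[gc _] := C0_valP g.
apply: (C0_domin _ (C0_valP g)); last first.
  by exists M => // x; rewrite normrM ler_wpM2r.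
move=> x; apply: cvgM; last exact: gc.
exact: (continuous_comp (cts_fun x) (fc (t x))).
Qed.
(* (f \o t) g; the factor f \o t alone need not vanish at infinity *)
Definition C0_pull t f g : C0 := MkC0 (C0_pull_subproof t f g).

Lemma C0_mul_subproof (f g : C0) : (fun x => f x * g x) \in C0_pred.
Proof.
have [M M0 fM] := C0_bounded (C0_valP f).
have /C0P[fc _] := C0_valP f; have /C0P[gc _] := C0_valP g.
apply: (C0_domin _ (C0_valP g)); last first.
  by exists M => // x; rewrite normrM ler_wpM2r.
by move=> x; exact: (cvgM (fc x) (gc x)).
Qed.
Definition C0_mul f g : C0 := MkC0 (C0_mul_subproof f g).

Lemma C0_conj_subproof (f : C0) : (fun x => (f x)^*) \in C0_pred.
Proof.
have /C0P[fc _] := C0_valP f.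
apply: (C0_domin _ (C0_valP f)).
  move=> x; apply/cvgrPdist_lt => e e0; have := fc x.
  move/cvgrPdist_lt => /(_ _ e0); apply: filterS => y.
  by rewrite -rmorphB norm_conjC.
by exists 1 => // x; rewrite norm_conjC mul1r.
Qed.
Definition C0_conj f : C0 := MkC0 (C0_conj_subproof f).

End C0.

Record hilbert (R : realType) := MkHilbert {
  hilbert_sort :> completeNormedModType (cplx R);
  hdot : {dot hilbert_sort for Num.conj};
  hilbert_normE : forall x : hilbert_sort, `|x| ^+ 2 = hdot x x }.

Section BoundedOperators.
Variables (R : realType) (H : hilbert R).
Local Notation C := (cplx R).

Definition bop_pred : {pred (H -> H)} :=
  fun T => `[< linear T /\ continuous T >].

Lemma bopP T : reflect (linear T /\ continuous T) (T \in bop_pred).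
Proof. exact: asboolP. Qed.

Lemma bop_submod : GRing.submod_closed bop_pred.
Proof.
split=> [|a S T /bopP[Sl Sc] /bopP[Tl Tc]]; apply/bopP; split.
- by move=> a x y; rewrite scaler0 addr0.
- by move=> x; exact: cvg_cst.
- move=> b x y; rewrite !fctE Sl Tl !scalerDr !scalerA [b * a]mulrC.
  by rewrite addrACA.
- by move=> x; exact: (cvgD (cvgZl_tmp (k := a) (Sc x)) (Tc x)).
Qed.
HB.instance Definition _ :=
  GRing.isSubmodClosed.Build C (H -> H) bop_pred bop_submod.

Record bop := MkBop { bop_val :> H -> H ; _ : bop_val \in bop_pred }.
HB.instance Definition _ := [isSub for bop_val].
HB.instance Definition _ := [Choice of bop by <:].
HB.instance Definition _ := [SubChoice_isSubLmodule of bop by <:].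

Lemma bop_valP (T : bop) : linear T /\ continuous T.
Proof. by apply/bopP; case: T. Qed.

Lemma bop_ext (S T : bop) : S =1 T -> S = T.
Proof. by move=> ST; apply/val_inj/funext. Qed.

Lemma bop_id_subproof : (id : H -> H) \in bop_pred.
Proof. by apply/bopP; split=> // x; exact: cvg_id. Qed.
Definition bop_id : bop := MkBop bop_id_subproof.

Lemma bop_comp_subproof (S T : bop) : (S \o T : H -> H) \in bop_pred.
Proof.
have [Sl Sc] := bop_valP S; have [Tl Tc] := bop_valP T.
apply/bopP; split=> [a x y|x] /=; first by rewrite Tl Sl.
exact: continuous_comp (Tc x) (Sc (T x)).
Qed.
Definition bop_comp S T : bop := MkBop (bop_comp_subproof S T).

Lemma bop_compA : associative bop_comp.
Proof. by move=> S T U; exact: bop_ext. Qed.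
Lemma bop_comp1l : left_id bop_id bop_comp.
Proof. by move=> S; exact: bop_ext. Qed.
Lemma bop_comp1r : right_id bop_id bop_comp.
Proof. by move=> S; exact: bop_ext. Qed.
Lemma bop_compDl : left_distributive bop_comp +%R.
Proof. by move=> S T U; exact: bop_ext. Qed.
Lemma bop_compDr : right_distributive bop_comp +%R.
Proof.
move=> S T U; apply: bop_ext => x /=; have [Sl _] := bop_valP S.
by have := Sl 1 (T x) (U x); rewrite !scale1r.
Qed.
HB.instance Definition _ := GRing.Zmodule_isPzRing.Build bop
  bop_compA bop_comp1l bop_comp1r bop_compDl bop_compDr.

(* The norm is extended-real valued only so that suprema need no side
   condition; it is finite on every (matrix of) bounded operator(s). *)
Definition opnorm (T : bop) : \bar R :=
  ereal_sup [set (complex.Re `|T x|)%:E | x in [set x : H | `|x| <= 1]].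

Definition l2norm k (x : 'I_k -> H) : R :=
  Num.sqrt (\sum_i complex.Re `|x i| ^+ 2).

(* the norm of a k x k matrix of operators acting on the direct sum H^k *)
Definition mxnorm k (a : 'M[bop]_k) : \bar R :=
  ereal_sup [set (l2norm (fun i => \sum_j (a i j : bop) (x j)))%:E
            | x in [set x : 'I_k -> H | l2norm x <= 1]].

Definition norm_closed (A : set bop) := forall T : bop,
  (forall e : R, 0 < e -> exists2 S, A S & (opnorm (T - S)%R < e%:E)%E) -> A T.

(* an identity is not required *)
Definition closed_subalgebra (A : set bop) :=
  [/\ A 0, forall (c : C) S T, A S -> A T -> A (c *: S + T),
      forall S T, A S -> A T -> A (S * T) & norm_closed A].

End BoundedOperators.

Record opalg (R : realType) := MkOpalg {
  opalg_space : hilbert R;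
  opalg_set : set (bop opalg_space);
  opalgP : closed_subalgebra opalg_set }.
Arguments opalg_set {R} o _.

(* A map between operator algebras A and B is represented by a function between
   the ambient algebras of operators; only its values on A are meaningful. *)
Section OperatorAlgebraMaps.
Variables (R : realType) (A B : opalg R).
Local Notation C := (cplx R).
Local Notation oA := (opalg_set A).
Local Notation oB := (opalg_set B).
Implicit Type phi : bop (opalg_space A) -> bop (opalg_space B).

Definition is_hom phi :=
  [/\ forall a, oA a -> oB (phi a),
      forall (c : C) a b, oA a -> oA b -> phi (c *: a + b) = c *: phi a + phi b
    & forall a b, oA a -> oA b -> phi (a * b) = phi a * phi b].

Definition is_cc_hom phi := is_hom phi /\
  forall k (a : 'M[bop (opalg_space A)]_k), (forall i j, oA (a i j)) ->
    (mxnorm (map_mx phi a) <= mxnorm a)%E.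

Definition is_ci_hom phi := is_hom phi /\
  forall k (a : 'M[bop (opalg_space A)]_k), (forall i j, oA (a i j)) ->
    mxnorm (map_mx phi a) = mxnorm a.

Definition ci_isomorphic := exists2 phi, is_ci_hom phi & phi @` oA = oB.

End OperatorAlgebraMaps.

Section Semicrossed.
Variables (R : realType) (X : topologicalType) (n : nat).
Variable tau : 'I_n -> continuousType X X.
Local Notation C := (cplx R).
Local Notation C0X := (C0 R X).

Record covariant_rep := MkCovariantRep {
  cr_space : hilbert R;
  cr_rho : {linear C0X -> bop cr_space};
  cr_T : 'I_n -> bop cr_space;
  cr_rhoM : forall f g, cr_rho (C0_mul f g) = cr_rho f * cr_rho g;
  cr_rho_star : forall f x y,
    hdot cr_space (cr_rho f x) y = hdot cr_space x (cr_rho (C0_conj f) y);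
  cr_nondegenerate : dense [set y : cr_space |
    exists m (f : 'I_m -> C0X) (x : 'I_m -> cr_space),
      y = \sum_i cr_rho (f i) (x i)];
  cr_contraction : forall i, (opnorm (cr_T i) <= 1)%E;
  cr_covariance : forall f g i,
    cr_rho f * cr_T i * cr_rho g = cr_T i * cr_rho (C0_pull (tau i) f g) }.

(* noncommutative polynomials, without constant term, in the symbols f and
   S_i f *)
Inductive scpoly :=
| SCfun of C0X
| SCgen of 'I_n & C0X
| SCadd of scpoly & scpoly
| SCscale of C & scpoly
| SCmul of scpoly & scpoly.

Fixpoint scpoly_eval (H : hilbert R) (u : C0X -> bop H)
    (s : 'I_n -> C0X -> bop H) (p : scpoly) : bop H :=
  match p with
  | SCfun f => u f
  | SCgen i f => s i f
  | SCadd p q => scpoly_eval u s p + scpoly_eval u s q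
  | SCscale c p => c *: scpoly_eval u s p
  | SCmul p q => scpoly_eval u s p * scpoly_eval u s q
  end.

(* (A, u, s) is the semicrossed product of X by tau, with u f and s i f the
   elements f and S_i f of A *)
Definition is_semicrossed (A : opalg R) (u : C0X -> bop (opalg_space A))
    (s : 'I_n -> C0X -> bop (opalg_space A)) :=
  opalg_set A = smallest (@closed_subalgebra R _)
                  (range u `|` \bigcup_i range (s i)) /\
  forall k (p : 'I_k -> 'I_k -> scpoly),
    mxnorm (\matrix_(i, j) scpoly_eval u s (p i j)) =
    ereal_sup [set r | exists pi : covariant_rep,
      r = mxnorm (\matrix_(i, j) scpoly_eval (cr_rho pi)
                    (fun l f => cr_T pi l * cr_rho pi f) (p i j))].

End Semicrossed.

(* (P, iota) is the free product of the A i amalgamated over D, where d i is the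
   embedding of D in A i that identifies D with a subalgebra of A i *)
Definition is_free_product (R : realType) (I D : Type) (A : I -> opalg R)
    (d : forall i, D -> bop (opalg_space (A i))) (P : opalg R)
    (iota : forall i, bop (opalg_space (A i)) -> bop (opalg_space P)) :=
  [/\ forall i, is_ci_hom (iota i),
      forall i j x, iota i (d i x) = iota j (d j x),
      opalg_set P = smallest (@closed_subalgebra R _)
                      (\bigcup_i (iota i @` opalg_set (A i)))
    & forall (S : opalg R)
        (pi : forall i, bop (opalg_space (A i)) -> bop (opalg_space S)),
      (forall i, is_cc_hom (pi i)) ->
      (forall i j x, pi i (d i x) = pi j (d j x)) ->
      exists phi : bop (opalg_space P) -> bop (opalg_space S),
        [/\ is_cc_hom phi,
            forall i a, opalg_set (A i) a -> phi (iota i a) = pi i a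
          & forall psi : bop (opalg_space P) -> bop (opalg_space S),
            is_cc_hom psi ->
            (forall i a, opalg_set (A i) a -> psi (iota i a) = pi i a) ->
            forall b, opalg_set P b -> psi b = phi b]].

(* Main.v *)
Require Import Defs.
From HB Require Import structures.
From mathcomp Require Import all_boot all_order all_algebra.
From mathcomp Require Import all_classical all_reals all_analysis.
From mathcomp Require Import complex ring.

(** The idea is to show that the semicrossed product A by all the maps is
    itself a free product of the one-variable semicrossed products B_i.  Any two
    free products of the same amalgam are completely isometrically isomorphic:
    the two universal maps are completely contractive and mutually inverse on
    generators, hence everywhere ([free_product_iso]).

    A completely contractive homomorphism out of a semicrossed product is built
    on noncommutative polynomials in the generators and extended by uniform
    continuity ([extension]); what has to be supplied is an inequality between
    the norms of matrices of polynomials.  Two such inequalities are needed.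

    First, B_i embeds completely isometrically in A ([restrict_embedding]).  The
    norm of a polynomial in the functions and S_i alone is the same supremum in
    A as in B_i: a covariant representation of the whole system yields one of
    the i-th map by forgetting the other contractions, and one of the i-th map
    yields one of the whole system by taking the other contractions to be 0.

    Secondly, let pi_i : B_i -> S be completely contractive homomorphisms that
    agree on C_0(X), and let u(f) and s_i(f) be the images of f and S_i f.  The
    norm of a polynomial in these operators must not exceed its norm in A
    ([covariant_system_dominated]), so a covariant representation has to be
    extracted from them.  It lives on the essential subspace H, where u(e) tends
    strongly to the identity as e runs through an approximate unit of C_0(X).
    On H, the limit of s_i(e) exists; it is a contraction T_i with
    T_i u(f) = s_i(f) and it satisfies the covariance relation.  The contractive
    homomorphism u is automatically selfadjoint on H: for real f the inequality
    |1 + i t f|^2 <= 1 + t^2 |f|^2 gives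
    |x + i t u(f) x|^2 <= (1 + t^2 |f|^2) |x|^2 for all real t, and the term
    linear in t can then only vanish ([ess_real_quadratic]).  Nothing is lost in
    passing to H, since p u(e) tends strongly to p for every polynomial p
    without constant term, while u(e) maps the whole space contractively into H
    ([ess_mxbound]).

    The bounds on u(f) and s_i(f) come from A and B_i being defined by
    *-representations of C_0(X), which are contractive because M^2 - |f|^2 is a
    square in the unitization of C_0(X) when |f| <= M ([contraction_defect]). *)

Set Implicit Arguments.
Unset Strict Implicit.
Unset Printing Implicit Defensive.
Import Order.TTheory GRing.Theory Num.Theory.
Import numFieldTopology.Exports numFieldNormedType.Exports.
Local Open Scope classical_set_scope.
Local Open Scope ring_scope.

(** * Real scalars inside the complex numbers *)

(** The embedding of the reals with codomain [cplx R], so that the order, norm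
    and topology of that type are the ones inferred. *)
Definition rc (R : realType) (r : R) : cplx R := (r%:C)%C.

Section RC.
Variable R : realType.
Local Notation C := (cplx R).
Implicit Types (r : R) (z : C).

Lemma ler_rc r1 r2 : (rc r1 <= rc r2) = (r1 <= r2).
Proof. exact: lecR. Qed.
Lemma ltr_rc r1 r2 : (rc r1 < rc r2) = (r1 < r2).
Proof. exact: ltcR. Qed.
Lemma rcD r1 r2 : rc (r1 + r2) = rc r1 + rc r2.
Proof. exact: (rmorphD (@real_complex R)). Qed.
Lemma rcM r1 r2 : rc (r1 * r2) = rc r1 * rc r2.
Proof. exact: (rmorphM (@real_complex R)). Qed.
Lemma ge0_rc z : 0 <= z -> z = rc (complex.Re z).
Proof. by move=> z0; rewrite /rc RRe_real// ger0_real. Qed.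
Lemma rc_ge0 r : (0 <= rc r) = (0 <= r).
Proof. exact: ler_rc. Qed.
Lemma rc_gt0 r : (0 < rc r) = (0 < r).
Proof. exact: ltr_rc. Qed.
Lemma rcN (r : R) : rc (- r) = - rc r.
Proof. exact: (rmorphN (@real_complex R)). Qed.
Lemma rcB (r s : R) : rc (r - s) = rc r - rc s.
Proof. by rewrite rcD rcN. Qed.

Lemma norm_rc (r : R) : `|rc r| = rc `|r|.
Proof.
have [r0|r0] := leP 0 r; first by rewrite !ger0_norm// rc_ge0.
by rewrite !ler0_norm ?rcN// ?ltW// -[0]/(rc 0) ltr_rc.
Qed.

Lemma rc_continuous : continuous (@rc R).
Proof.
move=> x; apply/cvgrPdist_lt => e e0.
have E0 : 0 < complex.Re e by rewrite -ltr_rc -ge0_rc// ltW.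
have := @cvg_id _ (nbhs x); move/cvgrPdist_lt => /(_ _ E0); apply: filterS => y xy.
by rewrite -rcB norm_rc (ge0_rc (ltW e0)) ltr_rc.
Qed.

End RC.

(** * Norms of vectors, operators and matrices of operators *)
Section Norms.
Variables (R : realType) (H : hilbert R).
Local Notation C := (cplx R).

Definition nrm (x : H) : R := complex.Re `|x|.

Lemma nrmE x : `|x| = rc (nrm x).
Proof. exact: ge0_rc. Qed.
Lemma nrm_ge0 x : 0 <= nrm x.
Proof. by rewrite -ler_rc -nrmE normr_ge0. Qed.
Lemma nrm0 : nrm 0 = 0.
Proof. by rewrite /nrm normr0. Qed.
Lemma nrm_eq0 x : nrm x = 0 -> x = 0.
Proof. by move=> h; apply/eqP; rewrite -normr_eq0 nrmE h. Qed.
Lemma nrmD x y : nrm (x + y) <= nrm x + nrm y.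
Proof. by rewrite -ler_rc rcD -!nrmE ler_normD. Qed.
Lemma nrmZ (c : C) x : nrm (c *: x) = complex.Re `|c| * nrm x.
Proof.
apply: complexI; rewrite -[LHS]/(rc _) -[RHS]/(rc _) rcM -!nrmE normrZ.
by congr (_ * _); apply: ge0_rc.
Qed.
Lemma nrmB x y : nrm (x - y) = nrm (y - x).
Proof. by rewrite /nrm distrC. Qed.

Section l2.
Variable k : nat.
Implicit Types x y : 'I_k -> H.

Lemma l2norm_ge0 x : 0 <= l2norm x.
Proof. exact: sqrtr_ge0. Qed.

Lemma l2norm_sqr x : l2norm x ^+ 2 = \sum_i nrm (x i) ^+ 2.
Proof. by rewrite sqr_sqrtr// sumr_ge0// => i _; exact: sqr_ge0. Qed.

Lemma nrm_le_l2norm x i : nrm (x i) <= l2norm x.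
Proof.
rewrite -(@ler_pXn2r _ 2) ?nnegrE ?nrm_ge0 ?l2norm_ge0// l2norm_sqr (bigD1 i)//=.
by rewrite lerDl sumr_ge0// => j _; exact: sqr_ge0.
Qed.

Lemma l2norm_le x y (c : R) : 0 <= c ->
  (forall i, nrm (x i) <= c * nrm (y i)) -> l2norm x <= c * l2norm y.
Proof.
move=> c0 xy; rewrite -(@ler_pXn2r _ 2) ?nnegrE ?mulr_ge0 ?l2norm_ge0//.
rewrite exprMn !l2norm_sqr mulr_sumr ler_sum// => i _; rewrite -exprMn.
by rewrite ler_pXn2r ?nnegrE ?mulr_ge0 ?nrm_ge0.
Qed.

Lemma l2norm_eq0 x : l2norm x = 0 -> forall i, x i = 0.
Proof.
move=> x0 i; apply: nrm_eq0; apply/le_anti/andP; split; last exact: nrm_ge0.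
by rewrite -x0 nrm_le_l2norm.
Qed.

Lemma l2norm0 : l2norm (fun _ : 'I_k => 0 : H) = 0.
Proof.
apply/eqP; rewrite -sqrf_eq0 l2norm_sqr big1// => i _.
by rewrite nrm0 expr0n.
Qed.

(** Minkowski's inequality from the pointwise bound
    (p + q)^2 <= (1 + d) p^2 + (1 + 1/d) q^2; the choice d = |y| / |x| makes the
    sum of the right-hand sides equal to (|x| + |y|)^2. *)
Lemma l2normD x y : l2norm (fun i => x i + y i) <= l2norm x + l2norm y.
Proof.
have [a0|a0] := eqVneq (l2norm x) 0.
  rewrite a0 add0r -[leRHS]mul1r; apply: l2norm_le => // i.
  by rewrite (l2norm_eq0 a0) add0r mul1r.
have [b0|b0] := eqVneq (l2norm y) 0.
  rewrite b0 addr0 -[leRHS]mul1r; apply: l2norm_le => // i.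
  by rewrite (l2norm_eq0 b0) addr0 mul1r.
have {}a0 : 0 < l2norm x by rewrite lt_neqAle eq_sym a0 l2norm_ge0.
have {}b0 : 0 < l2norm y by rewrite lt_neqAle eq_sym b0 l2norm_ge0.
set a := l2norm x in a0 *; set b := l2norm y in b0 *.
rewrite -(@ler_pXn2r _ 2) ?nnegrE ?addr_ge0 ?l2norm_ge0// l2norm_sqr.
pose d := b / a; have d0 : 0 < d by rewrite divr_gt0.
have -> : (a + b) ^+ 2 = (1 + d) * a ^+ 2 + (1 + d^-1) * b ^+ 2.
  rewrite /d; field; by rewrite !gt_eqF.
rewrite /a /b !l2norm_sqr !mulr_sumr -big_split ler_sum//= => i _.
apply: (@le_trans _ _ ((nrm (x i) + nrm (y i)) ^+ 2)).
  by rewrite ler_pXn2r ?nnegrE ?addr_ge0 ?nrm_ge0 ?nrmD.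
move: (nrm (x i)) (nrm (y i)) => p q; rewrite -subr_ge0.
suff -> : (1 + d) * p ^+ 2 + (1 + d^-1) * q ^+ 2 - (p + q) ^+ 2 =
          d * (p - d^-1 * q) ^+ 2 by rewrite mulr_ge0 ?sqr_ge0// ltW.
by field; rewrite gt_eqF.
Qed.

Lemma l2norm_sum x : l2norm x <= \sum_i nrm (x i).
Proof.
have s0 : 0 <= \sum_i nrm (x i) by rewrite sumr_ge0// => i _; exact: nrm_ge0.
rewrite -(@ler_pXn2r _ 2) ?nnegrE ?l2norm_ge0// l2norm_sqr.
rewrite expr2 mulr_suml ler_sum// => i _; rewrite expr2 ler_wpM2l ?nrm_ge0//.
by rewrite (bigD1 i)//= lerDl sumr_ge0// => j _; exact: nrm_ge0.
Qed.

End l2.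
End Norms.

Section Bounds.
Variables (R : realType) (H : hilbert R).
Local Notation C := (cplx R).
Implicit Types (S T : bop H).

Lemma bopZD T (c : C) x y : T (c *: x + y) = c *: T x + T y.
Proof. by have [Tl _] := bop_valP T; rewrite Tl. Qed.
Lemma bop0 T : T 0 = 0.
Proof. by have := bopZD T (-1) 0 0; rewrite scaler0 addr0 scaleN1r addNr. Qed.
Lemma bopD T x y : T (x + y) = T x + T y.
Proof. by rewrite -[x]scale1r bopZD !scale1r. Qed.
Lemma bopZ T (c : C) x : T (c *: x) = c *: T x.
Proof. by rewrite -[c *: x]addr0 bopZD bop0 addr0. Qed.
Lemma bopN T x : T (- x) = - T x.
Proof. by rewrite -scaleN1r bopZ scaleN1r. Qed.
Lemma bopB T x y : T (x - y) = T x - T y.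
Proof. by rewrite bopD bopN. Qed.

Lemma bopDE S T x : (S + T) x = S x + T x. Proof. by []. Qed.
Lemma bopBE S T x : (S - T) x = S x - T x. Proof. by []. Qed.
Lemma bopZE (c : C) T x : (c *: T) x = c *: T x. Proof. by []. Qed.
Lemma bopME S T x : (S * T) x = S (T x). Proof. by []. Qed.
Lemma bop0E x : (0 : bop H) x = 0. Proof. by []. Qed.

(** Norm estimates are carried as explicit bounds; [opnormP] and [mxnormP]
    translate them to the extended-real suprema. *)
Definition opbound T (M : R) := forall x, nrm (T x) <= M * nrm x.

Lemma bop_mk (f : H -> H) (M : R) : linear f ->
  (forall x, nrm (f x) <= M * nrm x) -> f \in @bop_pred R H.
Proof.
move=> fl fM; apply/bopP; split=> //.
pose g : {linear H -> H} := HB.pack f (GRing.isLinear.Build _ _ _ _ f fl).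
suff : continuous g by [].
apply/linear_bounded_continuous/linear_boundedP.
exists (rc M); split=> [|r /ltW Mr x /=].
  by rewrite /rc complex_real.
by rewrite (le_trans _ (ler_wpM2r (normr_ge0 x) Mr))// !nrmE -rcM ler_rc.
Qed.

Lemma bop_bounded T : exists2 M : R, 0 <= M & opbound T M.
Proof.
have [Tl Tc] := bop_valP T.
pose g : {linear H -> H} := HB.pack (bop_val T) (GRing.isLinear.Build _ _ _ _ _ Tl).
have /linear_bounded_continuous/linear_boundedP[M [Mr gM]] : continuous g by [].
have N0 : 0 <= `|M| + 1 by rewrite addr_ge0.
have : M < `|M| + 1 by rewrite (le_lt_trans (real_ler_norm _))// ltrDl.
move=> /gM => {}gM; exists (complex.Re (`|M| + 1)).
  by rewrite -rc_ge0 -ge0_rc.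
by move=> x; rewrite -ler_rc rcM -ge0_rc// -!nrmE; exact: gM.
Qed.
End Bounds.

Section OperatorNorms.
Variables (R : realType) (H : hilbert R).
Local Notation C := (cplx R).

Lemma nrm_rcZ (c : R) (x : H) : 0 <= c -> nrm (rc c *: x) = c * nrm x.
Proof. by move=> c0; rewrite nrmZ ger0_norm ?rc_ge0. Qed.

Lemma opnormP (T : bop H) (M : R) : 0 <= M ->
  (opnorm T <= M%:E)%E <-> opbound T M.
Proof.
move=> M0; split=> [TM x|TM]; last first.
  apply: ge_ereal_sup => _ [x /= x1 <-]; rewrite lee_fin (le_trans (TM x))//.
  by rewrite ler_piMr// -ler_rc -nrmE.
have [x0|x0] := eqVneq (nrm x) 0.
  by rewrite (nrm_eq0 x0) bop0 nrm0 mulr0.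
have {}x0 : 0 < nrm x by rewrite lt_neqAle eq_sym x0 nrm_ge0.
have h : 0 <= (nrm x)^-1 by rewrite invr_ge0 ltW.
rewrite -ler_pdivrMr// mulrC -nrm_rcZ// -bopZ -lee_fin (le_trans _ TM)//.
apply: ereal_sup_ubound; exists (rc (nrm x)^-1 *: x) => //=.
by rewrite nrmE ler_rc nrm_rcZ// mulVf// gt_eqF.
Qed.

Lemma opbound_ge (T : bop H) (M N : R) : M <= N -> opbound T M -> opbound T N.
Proof.
by move=> MN TM x; rewrite (le_trans (TM x))// ler_wpM2r ?nrm_ge0.
Qed.

Lemma opbound_lt (T : bop H) (e : R) : 0 < e ->
  (opnorm T < e%:E)%E -> opbound T e.
Proof. by move=> e0 /ltW; apply: (proj1 (opnormP _ (ltW e0))). Qed.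

Lemma opbound_opnorm (T : bop H) (e : R) : 0 < e ->
  opbound T (e / 2) -> (opnorm T < e%:E)%E.
Proof.
move=> e0; have h : 0 <= e / 2 by rewrite divr_ge0 ?ltW.
move=> /(proj2 (opnormP _ h))/le_lt_trans; apply.
by rewrite lte_fin ltr_pdivrMr// mulr_natr mulr2n ltrDl.
Qed.

Lemma opboundD (S T : bop H) (M N : R) :
  opbound S M -> opbound T N -> opbound (S + T) (M + N).
Proof.
move=> SM TN x; rewrite mulrDl (le_trans (nrmD _ _))//.
exact: lerD (SM x) (TN x).
Qed.

Lemma opboundBC (S T : bop H) (M : R) : opbound (S - T) M -> opbound (T - S) M.
Proof. by move=> h x; rewrite bopBE nrmB; exact: h. Qed.

Lemma opboundZ (c : C) (T : bop H) (M : R) :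
  opbound T M -> opbound (c *: T) (complex.Re `|c| * M).
Proof.
move=> TM x; rewrite bopZE nrmZ -mulrA; apply: ler_wpM2l; last exact: TM.
by rewrite -rc_ge0 -ge0_rc.
Qed.

Lemma opboundM (S T : bop H) (M N : R) : 0 <= M ->
  opbound S M -> opbound T N -> opbound (S * T) (M * N).
Proof.
move=> M0 SM TN x; rewrite bopME (le_trans (SM _))// -mulrA.
by apply: ler_wpM2l; last exact: TN.
Qed.

Section Mx.
Variable k : nat.
Implicit Types a b : 'M[bop H]_k.

Definition mxapp a (x : 'I_k -> H) : 'I_k -> H :=
  fun i => \sum_j (a i j : bop H) (x j).

Definition mxbound a (M : R) := forall x, l2norm (mxapp a x) <= M * l2norm x.

Lemma mxnorm_ge0 a : (0 <= mxnorm a)%E.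
Proof.
apply: ereal_sup_ubound; exists (fun=> 0) => /=; first by rewrite l2norm0.
rewrite (_ : (fun _ => _) = fun=> 0) ?l2norm0//.
by apply/funext => i; rewrite big1// => j _; rewrite bop0.
Qed.

Lemma l2norm_rcZ (c : R) (x : 'I_k -> H) : 0 <= c ->
  l2norm (fun i => rc c *: x i) = c * l2norm x.
Proof.
move=> c0; apply/eqP; rewrite -(@eqrXn2 _ 2) ?mulr_ge0 ?l2norm_ge0//.
rewrite exprMn !l2norm_sqr mulr_sumr; apply/eqP/eq_bigr => i _.
by rewrite nrm_rcZ// exprMn.
Qed.

Lemma mxnormP a (M : R) : 0 <= M -> (mxnorm a <= M%:E)%E <-> mxbound a M.
Proof.
move=> M0; split=> [aM x|aM]; last first.
  apply: ge_ereal_sup => _ [x /= x1 <-]; rewrite lee_fin (le_trans (aM x))//.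
  by rewrite ler_piMr.
have [x0|x0] := eqVneq (l2norm x) 0.
  rewrite x0 mulr0 (_ : mxapp a x = fun=> 0) ?l2norm0//.
  by apply/funext => i; apply: big1 => j _; rewrite (l2norm_eq0 x0) bop0.
have {}x0 : 0 < l2norm x by rewrite lt_neqAle eq_sym x0 l2norm_ge0.
have h : 0 <= (l2norm x)^-1 by rewrite invr_ge0 ltW.
rewrite -ler_pdivrMr// mulrC -l2norm_rcZ// -lee_fin (le_trans _ aM)//.
apply: ereal_sup_ubound; exists (fun i => rc (l2norm x)^-1 *: x i) => /=.
  by rewrite l2norm_rcZ// mulVf// gt_eqF.
congr (l2norm _)%:E; apply/funext => i; rewrite /mxapp scaler_sumr.
by apply: eq_bigr => j _; rewrite bopZ.
Qed.

Lemma mxboundD a b (M N : R) :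
  mxbound a M -> mxbound b N -> mxbound (a + b) (M + N).
Proof.
move=> aM bN x; rewrite mulrDl (le_trans _ (lerD (aM x) (bN x)))//.
rewrite (le_trans _ (l2normD _ _))// le_eqVlt; apply/orP; left.
apply/eqP; congr l2norm; apply/funext => i; rewrite /mxapp -big_split/=.
by apply: eq_bigr => j _; rewrite mxE.
Qed.

Lemma mxbound_entries a (M : R) : 0 <= M -> (forall i j, opbound (a i j) M) ->
  mxbound a (M * k%:R * k%:R).
Proof.
move=> M0 aM x; rewrite (le_trans (l2norm_sum _))//.
apply: (@le_trans _ _ (\sum_(i < k) (M * k%:R) * l2norm x)).
  apply: ler_sum => i _; rewrite /mxapp.
  apply: (@le_trans _ _ (\sum_(j < k) M * l2norm x)).
    elim/big_ind2: _ => [|u c v d uc vd|j _]; first by rewrite nrm0.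
      by rewrite (le_trans (nrmD _ _))// lerD.
    by rewrite (le_trans (aM _ _ _))// ler_wpM2l// nrm_le_l2norm.
  by rewrite sumr_const card_ord -[leLHS]mulr_natr mulrAC.
by rewrite sumr_const card_ord -[leLHS]mulr_natr mulrAC.
Qed.

End Mx.

Lemma mxbound1 (T : bop H) (M : R) :
  mxbound (\matrix_(i < 1, j < 1) T) M <-> opbound T M.
Proof.
have l1 (x : 'I_1 -> H) : l2norm x = nrm (x ord0).
  apply/eqP; rewrite -(@eqrXn2 _ 2) ?l2norm_ge0 ?nrm_ge0// l2norm_sqr.
  by rewrite big_ord1.
split=> [h x|h x].
  by have := h (fun=> x); rewrite !l1 /mxapp big_ord1 mxE.
by rewrite !l1 /mxapp big_ord1 mxE.
Qed.

End OperatorNorms.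

(** Comparing norms of matrices over two different Hilbert spaces amounts to
    transferring explicit bounds. *)
Lemma le_mxnorm (R : realType) (H K : hilbert R) k (a : 'M[bop H]_k)
    (b : 'M[bop K]_k) :
  (mxnorm a <= mxnorm b)%E <->
  forall M : R, 0 <= M -> mxbound b M -> mxbound a M.
Proof.
split=> [ab M M0 bM|h].
  by apply/(mxnormP _ M0)/(le_trans ab)/mxnormP.
have := mxnorm_ge0 b; case E : (mxnorm b) => [M| |]//.
  rewrite lee_fin => M0; apply/(mxnormP _ M0)/h => //.
  by apply/(mxnormP _ M0); rewrite E.
by move=> _; rewrite leey.
Qed.

(** * Strong limits and completeness *)
Section StrongLimits.
Variables (R : realType) (H : hilbert R).
Local Notation C := (cplx R).

Lemma cvg_nrmP I (F : set_system I) {FF : Filter F} (f : I -> H) (z : H) :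
  f @ F --> z <-> forall e : R, 0 < e -> \forall i \near F, nrm (z - f i) <= e.
Proof.
split=> [/cvgrPdist_le h e e0|h].
  have /h : 0 < rc e by rewrite rc_gt0.
  by apply: filterS => i; rewrite nrmE ler_rc.
apply/cvgrPdist_le => e e0; rewrite (ge0_rc (ltW e0)).
have /h : 0 < complex.Re e by rewrite -ltr_rc -ge0_rc// ltW.
by apply: filterS => i; rewrite nrmE ler_rc.
Qed.

Section Filter.
Context I (F : set_system I) {PF : ProperFilter F}.

Lemma cvg_nrm_le (f : I -> H) (z : H) (c : R) : f @ F --> z ->
  (\forall i \near F, nrm (f i) <= c) -> nrm z <= c.
Proof.
move=> /cvg_nrmP fz fc; apply/ler_addgt0Pr => e e0.
near F => i; rewrite -(subrK (f i) z) (le_trans (nrmD _ _))// addrC lerD//.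
  by near: i.
by near: i; exact: fz.
Unshelve. all: by end_near. Qed.

Lemma cvg_nrm_cauchy (f : I -> H) : (forall e : R, 0 < e -> exists z,
    \forall i \near F, nrm (z - f i) <= e) -> cvg (f @ F).
Proof.
move=> h; apply: cauchy_cvg; apply: cauchy_exP => e e0.
have e2 : 0 < complex.Re e / 2.
  by rewrite divr_gt0// -ltr_rc -ge0_rc// ltW.
have [z zf] := h _ e2; exists z; apply: filterS zf => i zi.
rewrite /= -ball_normE/= nrmE (ge0_rc (ltW e0)) ltr_rc (le_lt_trans zi)//.
by rewrite ltr_pdivrMr// mulr_natr mulr2n ltrDl -ltr_rc -ge0_rc// ltW.
Qed.

Lemma cvg_bop (T : bop H) (f : I -> H) (z : H) : f @ F --> z ->
  (fun i => T (f i)) @ F --> T z.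
Proof.
move=> fz; have [_ Tc] := bop_valP T.
by apply: (@continuous_cvg _ _ _ F _ f (T : H -> H) z) => //; exact: Tc.
Qed.

Lemma cvg_nrm_sum k (f : 'I_k -> I -> H) (l : 'I_k -> H) :
  (forall j, f j @ F --> l j) -> (fun i => \sum_j f j i) @ F --> \sum_j l j.
Proof.
move=> fl; rewrite (_ : (fun i => _) = \sum_j f j); last first.
  by apply/funext => i; rewrite fct_sumE.
elim/big_ind2: _ => [|f1 l1 f2 l2 h1 h2|//]; first exact: cvg_cst.
exact: cvgD h1 h2.
Qed.

(** The eventual uniform bound passes to the pointwise limit, which makes the
    limit continuous. *)
Lemma strong_limit (S : I -> bop H) (M : R) :
  (\forall i \near F, opbound (S i) M) -> (forall x, cvg (S^~ x @ F)) ->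
  exists2 T : bop H, forall x, S^~ x @ F --> T x & opbound T M.
Proof.
move=> SM Sc; pose f x := lim (S^~ x @ F).
have fM x : nrm (f x) <= M * nrm x.
  by apply: cvg_nrm_le (Sc x) _; apply: filterS SM => i; exact.
have fl : linear f.
  move=> a x y; apply/cvg_lim => //.
  rewrite (_ : S^~ _ = fun i => a *: S i x + S i y).
    by apply: cvgD (Sc y); apply: cvgZl_tmp; exact: (Sc x).
  by apply/funext => i; rewrite bopZD.
by exists (MkBop (bop_mk fl fM)) => // x; exact: Sc.
Qed.

Lemma bop_complete (S : I -> bop H) :
  (forall e : R, 0 < e -> exists2 A, F A &
    forall i j, A i -> A j -> opbound (S i - S j) e) ->
  exists T : bop H, forall e : R, 0 < e ->
    \forall i \near F, opbound (T - S i) e.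
Proof.
move=> h.
have Sc x : cvg (S^~ x @ F).
  apply: cvg_nrm_cauchy => e e0.
  (* nrm x + 1 replaces nrm x, which may be 0 *)
  have d0 : 0 < e / (nrm x + 1) by rewrite divr_gt0// ltr_wpDl ?nrm_ge0.
  have [A FA AS] := h _ d0; have [i Ai] := filter_ex FA.
  exists (S i x); apply: filterS FA => j Aj.
  rewrite -bopBE (le_trans (AS i j Ai Aj x))// mulrAC ler_pdivrMr ?ltr_wpDl ?nrm_ge0//.
  by rewrite ler_wpM2l ?lerDl// ltW.
have [A FA AS] := h 1 ltr01; have [i Ai] := filter_ex FA.
have [M M0 SM] := bop_bounded (S i).
have : \forall j \near F, opbound (S j) (1 + M).
  by apply: filterS FA => j Aj; rewrite -(subrK (S i) (S j)); apply: opboundD => //; exact: AS.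
move=> /strong_limit/(_ Sc)[T ST _]; exists T => e e0.
have [B FB BS] := h _ e0; apply: filterS (FB) => j Bj x.
apply: (@cvg_nrm_le (fun l => S l x - S j x)).
  by apply: cvgB (ST x) _; exact: cvg_cst.
by apply: filterS FB => l Bl; exact: BS.
Qed.

End Filter.
End StrongLimits.

(** * Homomorphisms determined by their values on generators *)
Section Approximation.
Variables (R : realType) (H : hilbert R).
Local Notation C := (cplx R).
Implicit Types S T P Q : bop H.

Lemma opbound_eq S T : (forall e : R, 0 < e -> opbound (S - T) e) -> S = T.
Proof.
move=> h; apply: bop_ext => x; apply/eqP; rewrite -subr_eq0; apply/eqP/nrm_eq0.
apply/le_anti; rewrite nrm_ge0 andbT; apply/ler_addgt0Pr => e e0; rewrite add0r.
have d0 : 0 < e / (nrm x + 1) by rewrite divr_gt0// ltr_wpDl ?nrm_ge0.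
rewrite -bopBE (le_trans (h _ d0 x))// mulrAC.
rewrite ler_pdivrMr ?ltr_wpDl ?nrm_ge0//.
by rewrite ler_wpM2l ?lerDl// ltW.
Qed.

Lemma approx_linear (c : C) (e : R) : 0 < e -> exists2 d : R, 0 < d &
  forall S T P Q, opbound (S - P) d -> opbound (T - Q) d ->
    opbound (c *: S + T - (c *: P + Q)) e.
Proof.
move=> e0; have c0 : 0 <= complex.Re `|c| by rewrite -rc_ge0 -ge0_rc.
have c1 : 0 < complex.Re `|c| + 1 by rewrite ltr_wpDl.
exists (e / (complex.Re `|c| + 1)); first by rewrite divr_gt0.
move=> S T P Q SP TQ.
have -> : c *: S + T - (c *: P + Q) = c *: (S - P) + (T - Q).
  by rewrite scalerBr opprD addrACA.
apply: opbound_ge (opboundD (opboundZ c SP) TQ).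
rewrite -[X in _ + X]mul1r -mulrDl.
by rewrite mulrCA divff ?mulr1// gt_eqF.
Qed.

Lemma approx_mul S T (e : R) : 0 < e -> exists2 d : R, 0 < d &
  forall P Q, opbound (S - P) d -> opbound (T - Q) d -> opbound (S * T - P * Q) e.
Proof.
move=> e0; have [M M0 SM] := bop_bounded S; have [N N0 TN] := bop_bounded T.
have D0 : 0 < M + (N + 1) by rewrite ltr_wpDl// ltr_wpDl.
pose d := Num.min 1 (e / (M + (N + 1))).
have d0 : 0 < d by rewrite lt_min ltr01 divr_gt0.
have d1 : d <= 1 by rewrite ge_min lexx.
have de : d <= e / (M + (N + 1)) by rewrite ge_min lexx orbT.
exists d => // P Q SP TQ.
have QN : opbound Q (N + 1).
  rewrite -(subrK T Q) addrC; apply: opboundD => //.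
  exact: opbound_ge d1 (opboundBC TQ).
have -> : S * T - P * Q = S * (T - Q) + (S - P) * Q.
  by rewrite mulrBr mulrBl addrA subrK.
apply: opbound_ge (opboundD (opboundM M0 SM TQ) (opboundM (ltW d0) SP QN)).
rewrite [d * _]mulrC -mulrDl (le_trans (ler_wpM2l (ltW D0) de))//.
by rewrite mulrCA divff ?mulr1// gt_eqF.
Qed.

Lemma norm_closedP (A : set (bop H)) T : norm_closed A ->
  (forall e : R, 0 < e -> exists2 S, A S & opbound (T - S) e) -> A T.
Proof.
move=> Ac h; apply: Ac => e e0; have [|S AS TS] := h (e / 2).
  by rewrite divr_gt0.
by exists S => //; exact: opbound_opnorm.
Qed.

End Approximation.

Section HomUniqueness.
Variables (R : realType) (A B : opalg R).
Local Notation C := (cplx R).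
Implicit Types phi psi : bop (opalg_space A) -> bop (opalg_space B).

Lemma opalg0 : opalg_set A 0. Proof. by have [] := opalgP A. Qed.
Lemma opalgZD (c : C) S T : opalg_set A S -> opalg_set A T ->
  opalg_set A (c *: S + T).
Proof. by have [_ h _ _] := opalgP A; exact: h. Qed.
Lemma opalgM S T : opalg_set A S -> opalg_set A T -> opalg_set A (S * T).
Proof. by have [_ _ h _] := opalgP A; exact: h. Qed.
Lemma opalgB S T : opalg_set A S -> opalg_set A T -> opalg_set A (S - T).
Proof. by move=> SA TA; rewrite addrC -scaleN1r; exact: opalgZD. Qed.
Lemma opalgD S T : opalg_set A S -> opalg_set A T -> opalg_set A (S + T).
Proof. by move=> SA TA; rewrite -[S]scale1r; exact: opalgZD. Qed.
Lemma opalgZ (c : C) S : opalg_set A S -> opalg_set A (c *: S).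
Proof. by move=> SA; rewrite -[_ *: _]addr0; exact/opalgZD/opalg0. Qed.

Section OneHom.
Variable phi : bop (opalg_space A) -> bop (opalg_space B).
Hypothesis hphi : is_hom phi.

Lemma hom0 : phi 0 = 0.
Proof.
have [_ h _] := hphi; have := h (-1) 0 0 opalg0 opalg0.
by rewrite scaler0 addr0 scaleN1r addNr.
Qed.
Lemma homZ (c : C) S : opalg_set A S -> phi (c *: S) = c *: phi S.
Proof.
have [_ h _] := hphi => SA.
by have := h c S 0 SA opalg0; rewrite addr0 hom0 addr0.
Qed.
Lemma homD S T : opalg_set A S -> opalg_set A T -> phi (S + T) = phi S + phi T.
Proof.
have [_ h _] := hphi => SA TA.
by have := h 1 S T SA TA; rewrite !scale1r.
Qed.
Lemma homB S T : opalg_set A S -> opalg_set A T -> phi (S - T) = phi S - phi T.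
Proof.
move=> SA TA; rewrite -[- T]scaleN1r homD//; last exact: opalgZ.
by rewrite homZ// scaleN1r.
Qed.
Lemma homM S T : opalg_set A S -> opalg_set A T -> phi (S * T) = phi S * phi T.
Proof. by have [_ _ h] := hphi; exact: h. Qed.
End OneHom.

Lemma cc_opbound phi T (M : R) : is_cc_hom phi -> opalg_set A T -> 0 <= M ->
  opbound T M -> opbound (phi T) M.
Proof.
move=> [_ /(_ 1 (\matrix_(_, _) T)) h] TA M0 TM; apply/mxbound1.
have -> : \matrix_(_ < 1, _ < 1) phi T = map_mx phi (\matrix_(_, _) T).
  by apply/matrixP => i j; rewrite !mxE.
apply: (proj1 (le_mxnorm _ _) (h _)) => // [i j|]; first by rewrite mxE.
exact/mxbound1.
Qed.

(** The elements on which the two maps agree form a norm-closed subalgebra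
    containing the generators. *)
Lemma cc_hom_unique (G : set (bop (opalg_space A))) phi psi :
  opalg_set A = smallest (@closed_subalgebra R _) G ->
  is_cc_hom phi -> is_cc_hom psi -> (forall g, G g -> phi g = psi g) ->
  forall a, opalg_set A a -> phi a = psi a.
Proof.
move=> AG cphi cpsi pp a; pose Z := [set T | opalg_set A T /\ phi T = psi T].
have [hphi _] := cphi; have [hpsi _] := cpsi.
suff Zsub : closed_subalgebra Z.
  rewrite {1}AG => /(_ Z) []//; split=> // g Gg; split; last exact: pp.
  by rewrite AG => Y [_]; exact.
split.
- by split; [exact: opalg0|rewrite !hom0].
- move=> c S T [AS eS] [AT eT]; split; first exact: opalgZD.
  have AcS : opalg_set A (c *: S) by exact: opalgZ.
  by rewrite !homD// !homZ// eS eT.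
- by move=> S T [AS eS] [AT eT]; split; [exact: opalgM|rewrite !homM// eS eT].
- move=> T h.
  have AT : opalg_set A T.
    have [_ _ _] := opalgP A; apply => e /h[S [AS _] TS].
    by exists S.
  split=> //; apply: opbound_eq => e e0.
  have e2 : 0 < e / 2 by rewrite divr_gt0.
  have [S [AS eS] /(opbound_lt e2) TS] := h _ e2.
  rewrite -(subrK (phi S) (phi T)) -addrA {2}eS [e]splitr; apply: opboundD.
    rewrite -homB//; apply: cc_opbound => //; [exact: opalgB|exact: ltW].
  apply: opboundBC; rewrite -homB//.
  by apply: cc_opbound => //; [exact: opalgB|exact: ltW].
Qed.

End HomUniqueness.

Section Extension.
Variables (R : realType) (X : topologicalType) (n : nat).
Local Notation C := (cplx R).
Local Notation C0X := (C0 R X).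
Local Notation poly := (scpoly R X n).

Definition scgen (H : hilbert R) (u : C0X -> bop H) (s : 'I_n -> C0X -> bop H) :=
  range u `|` \bigcup_i range (s i).

Section Rel.
Variables (H K : hilbert R).
Variables (u : C0X -> bop H) (s : 'I_n -> C0X -> bop H).
Variables (u' : C0X -> bop K) (s' : 'I_n -> C0X -> bop K).
Local Notation ev := (scpoly_eval u s).
Local Notation ev' := (scpoly_eval u' s').

(** The graph of the homomorphism under construction: T and T' are limits of
    the values of the same polynomials, in the generators of the source and in
    their prescribed images.  The relation is symmetric in the two systems, so
    that estimates in both directions come from a single lemma. *)
Definition coapprox (T : bop H) (T' : bop K) := forall e : R, 0 < e ->
  exists p : poly, opbound (T - ev p) e /\ opbound (T' - ev' p) e.

Lemma opbound_subrr (L : hilbert R) (T : bop L) (e : R) : 0 < e ->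
  opbound (T - T) e.
Proof.
by move=> e0 x; rewrite subrr bop0E nrm0 mulr_ge0 ?nrm_ge0// ltW.
Qed.

Lemma coapprox_eval p : coapprox (ev p) (ev' p).
Proof. by move=> e e0; exists p; split; exact: opbound_subrr. Qed.

Lemma coapprox_linear (c : C) S S' T T' : coapprox S S' -> coapprox T T' ->
  coapprox (c *: S + T) (c *: S' + T').
Proof.
move=> SS TT e e0.
have [d1 d10 h1] := approx_linear H c e0; have [d2 d20 h2] := approx_linear K c e0.
have d0 : 0 < Num.min d1 d2 by rewrite lt_min d10.
have [p [Sp Sp']] := SS _ d0; have [q [Tq Tq']] := TT _ d0.
have [l1 l2] : Num.min d1 d2 <= d1 /\ Num.min d1 d2 <= d2.
  by rewrite !ge_min !lexx orbT.
exists (SCadd (SCscale c p) q); split=> /=.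
  by apply: h1; [exact: opbound_ge Sp|exact: opbound_ge Tq].
by apply: h2; [exact: opbound_ge Sp'|exact: opbound_ge Tq'].
Qed.

Lemma coapprox_mul S S' T T' : coapprox S S' -> coapprox T T' ->
  coapprox (S * T) (S' * T').
Proof.
move=> SS TT e e0.
have [d1 d10 h1] := approx_mul S T e0; have [d2 d20 h2] := approx_mul S' T' e0.
have d0 : 0 < Num.min d1 d2 by rewrite lt_min d10.
have [p [Sp Sp']] := SS _ d0; have [q [Tq Tq']] := TT _ d0.
have [l1 l2] : Num.min d1 d2 <= d1 /\ Num.min d1 d2 <= d2.
  by rewrite !ge_min !lexx orbT.
exists (SCmul p q); split=> /=.
  by apply: h1; [exact: opbound_ge Sp|exact: opbound_ge Tq].
by apply: h2; [exact: opbound_ge Sp'|exact: opbound_ge Tq'].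
Qed.

Lemma coapprox_closed T T' : (forall e : R, 0 < e -> exists S S',
    [/\ coapprox S S', opbound (T - S) e & opbound (T' - S') e]) ->
  coapprox T T'.
Proof.
move=> h e e0; have e2 : 0 < e / 2 by rewrite divr_gt0.
have [S [S' [/(_ _ e2)[p [Sp Sp']] TS TS']]] := h _ e2.
exists p; rewrite [e]splitr; split.
  by rewrite -(subrK S T) -addrA; exact: opboundD.
by rewrite -(subrK S' T') -addrA; exact: opboundD.
Qed.

Definition norm_dominated := forall k (p : 'I_k -> 'I_k -> poly),
  (mxnorm (\matrix_(i, j) ev' (p i j)) <= mxnorm (\matrix_(i, j) ev (p i j)))%E.

Hypothesis dom : norm_dominated.

Lemma dominated_opbound p (M : R) : 0 <= M -> opbound (ev p) M -> opbound (ev' p) M.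
Proof.
move=> M0 pM; apply/mxbound1; have /le_mxnorm := dom (fun _ _ : 'I_1 => p).
by apply=> //; exact/mxbound1.
Qed.

Lemma dominated_opboundB p q (M : R) : 0 <= M ->
  opbound (ev p - ev q) M -> opbound (ev' p - ev' q) M.
Proof.
move=> M0 h; have := @dominated_opbound (SCadd p (SCscale (-1) q)) M M0.
by rewrite /= !scaleN1r; apply.
Qed.

Lemma coapprox_fun T T' T'' : coapprox T T' -> coapprox T T'' -> T' = T''.
Proof.
move=> TT' TT''; apply: opbound_eq => e e0.
have d0 : 0 < e / 2 / 2 by rewrite !divr_gt0.
have [p [Tp Tp']] := TT' _ d0; have [q [Tq Tq']] := TT'' _ d0.
have -> : T' - T'' = (T' - ev' p) + (ev' p - ev' q) + (ev' q - T'').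
  by rewrite -[RHS]addrA [X in _ = _ + X]addrA subrK addrA subrK.
have -> : e = e / 2 / 2 + e / 2 + e / 2 / 2.
  by rewrite addrAC -!splitr.
apply: opboundD; last exact: opboundBC.
apply: opboundD => //; apply: dominated_opboundB; first by rewrite divr_ge0 ?ltW.
have -> : ev p - ev q = (ev p - T) + (T - ev q) by rewrite addrA subrK.
by rewrite [e / 2]splitr; apply: opboundD => //; exact: opboundBC.
Qed.

(** The polynomials close to T form a Cauchy filter; domination makes their
    images Cauchy as well, and operators are complete for the norm. *)
Lemma coapprox_ex T : (forall e : R, 0 < e -> exists p : poly, opbound (T - ev p) e) ->
  exists T', coapprox T T'.
Proof.
move=> h; pose F := filter_from [set e : R | 0 < e]
  (fun e => [set p : poly | opbound (T - ev p) e]).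
have FF : ProperFilter F.
  apply: filter_from_proper => [|e /h[p hp]]; last by exists p.
  apply: filter_from_filter => [|e1 e2 /= e10 e20]; first by exists 1; exact: ltr01.
  exists (Num.min e1 e2) => /=; first by rewrite lt_min e10.
  by move=> p /= Tp; split; apply: opbound_ge Tp; rewrite ge_min lexx ?orbT.
have [|T' TT'] := @bop_complete R K _ F FF ev'.
  move=> e e0; have e2 : 0 < e / 2 by rewrite divr_gt0.
  exists [set p | opbound (T - ev p) (e / 2)]; first by exists (e / 2).
  move=> p q /= Tp Tq; apply: dominated_opboundB; first exact: ltW.
  have -> : ev p - ev q = (ev p - T) + (T - ev q) by rewrite addrA subrK.
  by rewrite [e]splitr; apply: opboundD => //; exact: opboundBC.
exists T' => e e0.
have Fe : F [set p | opbound (T - ev p) e] by exists e.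
by have /filter_ex[p [Tp Tp']] := @filterI _ F FF _ _ Fe (TT' _ e0); exists p.
Qed.

(** Domination is applied to a matrix of polynomials that approximates a and b
    simultaneously, entry by entry. *)
Lemma coapprox_mxnorm k (a : 'M[bop H]_k) (b : 'M[bop K]_k) :
  (forall i j, coapprox (a i j) (b i j)) -> (mxnorm b <= mxnorm a)%E.
Proof.
move=> ab; apply/le_mxnorm => M M0 aM x.
apply/ler_addgt0Pr => e e0.
(* there are k^2 entries, each contributing twice (in a and in b), and the error
   is measured on x; the summands 1 keep q positive *)
pose q : R := (l2norm x + 1) * k%:R * k%:R * 2 + 1.
have q0 : 0 < q by rewrite ltr_wpDl// !mulr_ge0 ?addr_ge0 ?l2norm_ge0.
have d0 : 0 < e / q by rewrite divr_gt0.
pose p i j := projT1 (cid (ab i j _ d0)).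
have ap i j : opbound (a i j - ev (p i j)) (e / q) by rewrite /p; case: cid => ? [].
have bp i j : opbound (b i j - ev' (p i j)) (e / q) by rewrite /p; case: cid => ? [].
have D0 : 0 <= e / q * k%:R * k%:R.
  by do 2 (apply: mulr_ge0; last by []); exact: ltW.
have pM : mxbound (\matrix_(i, j) ev (p i j)) (e / q * k%:R * k%:R + M).
  rewrite -(subrK a (\matrix_(i, j) ev (p i j))); apply: mxboundD => //.
  apply: mxbound_entries => [|i j]; first exact: ltW.
  by rewrite !mxE; exact: opboundBC.
have {}pM := proj1 (le_mxnorm _ _) (dom p) _ (addr_ge0 D0 M0) pM.
have /(_ x) : mxbound b (e / q * k%:R * k%:R + (e / q * k%:R * k%:R + M)).
  rewrite -(subrK (\matrix_(i, j) ev' (p i j)) b); apply: mxboundD => //.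
  apply: mxbound_entries => [|i j]; first exact: ltW.
  by rewrite !mxE.
move=> /le_trans; apply; rewrite addrA mulrDl addrC lerD2l.
have -> : (e / q * k%:R * k%:R + e / q * k%:R * k%:R) * l2norm x =
          e * ((l2norm x * k%:R * k%:R * 2) / q) by ring.
apply: ler_piMr; first exact: ltW.
rewrite ler_pdivrMr// mul1r /q.
rewrite (@le_trans _ _ ((l2norm x + 1) * k%:R * k%:R * 2)) ?lerDl//.
by rewrite !ler_wpM2r// lerDl.
Qed.

End Rel.

Lemma coapprox_sym H K u s u' s' T T' : @coapprox H K u s u' s' T T' ->
  coapprox u' s' u s T' T.
Proof. by move=> h e /h[p [Tp Tp']]; exists p. Qed.

Section Generated.
Variables (A : opalg R) (u : C0X -> bop (opalg_space A)).
Variable s : 'I_n -> C0X -> bop (opalg_space A).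
Hypothesis genA : opalg_set A = smallest (@closed_subalgebra R _) (scgen u s).
Local Notation ev := (scpoly_eval u s).

Lemma gen_u f : opalg_set A (u f).
Proof. by rewrite genA => Y [_]; apply; left; exists f. Qed.
Lemma gen_s i f : opalg_set A (s i f).
Proof. by rewrite genA => Y [_]; apply; right; exists i => //; exists f. Qed.

(** The norm-limits of polynomials form a closed subalgebra; they are encoded as
    the T with [coapprox T T] relative to one and the same system, which makes
    the closure properties of [coapprox] applicable. *)
Lemma gen_approx T : opalg_set A T ->
  forall e : R, 0 < e -> exists p : poly, opbound (T - ev p) e.
Proof.
pose Z := [set T | coapprox u s u s T T].
have Zsub : closed_subalgebra Z.
  split.
  - have := coapprox_eval u s u s (SCscale 0 (SCfun n (0 : C0X))).
    by rewrite /= scale0r.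
  - by move=> c S T1 SZ TZ; exact: coapprox_linear.
  - by move=> S T1 SZ TZ; exact: coapprox_mul.
  - move=> T1 h; apply: coapprox_closed => e e0.
    by have [S ZS /(opbound_lt e0) TS] := h _ e0; exists S, S.
rewrite {1}genA => /(_ Z) hT e e0.
have /(_ _ e0)[p []] : Z T; last by exists p.
apply: hT; split=> // _ [[f _ <-]|[i _ [f _ <-]]].
  exact: (coapprox_eval u s u s (SCfun n f)).
exact: (coapprox_eval u s u s (SCgen i f)).
Qed.
End Generated.

Lemma opalg_eval (A : opalg R) u s (p : poly) : (forall f, opalg_set A (u f)) ->
  (forall i f, opalg_set A (s i f)) -> opalg_set A (scpoly_eval u s p).
Proof.
move=> Au As; elim: p => //= [p hp q hq|c p hp|p hp q hq].
- exact: opalgD.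
- exact: opalgZ.
- exact: opalgM.
Qed.

(** Domination makes [coapprox] the graph of a map, defined on all of A because
    polynomials are dense there; the relation respects sums, scalars and
    products, so the map is a homomorphism.  Domination in the other direction
    turns the norm estimate into an equality. *)
Lemma extension (A S : opalg R) u s u' s' :
  opalg_set A = smallest (@closed_subalgebra R _) (scgen u s) ->
  (forall f, opalg_set S (u' f)) -> (forall i f, opalg_set S (s' i f)) ->
  norm_dominated u s u' s' ->
  exists phi : bop (opalg_space A) -> bop (opalg_space S),
    [/\ is_cc_hom phi, forall p, phi (scpoly_eval u s p) = scpoly_eval u' s' p
      & norm_dominated u' s' u s -> is_ci_hom phi].
Proof.
move=> genA Su Ss dom.
(* the value 0 is only taken outside A *)
pose phi T := xget 0 [set T' | coapprox u s u' s' T T'].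
have phiP T : opalg_set A T -> coapprox u s u' s' T (phi T).
  move=> /(gen_approx genA)/(coapprox_ex dom)[T' TT'].
  exact: (xgetPex 0 (ex_intro _ T' TT')).
have phiE T T' : opalg_set A T -> coapprox u s u' s' T T' -> phi T = T'.
  by move=> /phiP h1 h2; exact: (coapprox_fun dom h1 h2).
have homphi : is_hom phi.
  split.
  - move=> T /phiP TT; have [_ _ _ Sc] := opalgP S.
    apply: norm_closedP Sc _ => e e0; have [p [_ h]] := TT _ e0.
    by exists (scpoly_eval u' s' p) => //; exact: opalg_eval.
  - move=> c a b Aa Ab; apply: phiE; first exact: opalgZD.
    by apply: coapprox_linear; exact: phiP.
  - move=> a b Aa Ab; apply: phiE; first exact: opalgM.
    by apply: coapprox_mul; exact: phiP.
have ccphi : is_cc_hom phi.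
  split=> // k a Aa; apply: (coapprox_mxnorm dom) => i j; rewrite mxE.
  exact: phiP.
exists phi; split=> // [p|dom'].
  apply: phiE; last exact: coapprox_eval.
  by apply: opalg_eval; [exact: gen_u genA|exact: gen_s genA].
split=> // k a Aa; apply/le_anti/andP; split; first exact: ccphi.2.
apply: (coapprox_mxnorm dom') => i j; rewrite mxE.
by apply: coapprox_sym; exact: phiP.
Qed.

End Extension.

(** * Approximate units of C_0(X) *)
Section C0Theory.
Variables (R : realType) (X : topologicalType).
Local Notation C := (cplx R).
Local Notation C0X := (C0 R X).
Implicit Types f g h : C0X.

Lemma C0_ext f g : f =1 g -> f = g.
Proof. by move=> fg; apply/val_inj/funext. Qed.

Lemma C0_mulE f g x : C0_mul f g x = f x * g x. Proof. by []. Qed.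
Lemma C0_pullE t f g x : C0_pull t f g x = f (t x) * g x. Proof. by []. Qed.
Lemma C0_conjE f x : C0_conj f x = (f x)^*. Proof. by []. Qed.
Lemma C0_addE f g x : (f + g) x = f x + g x. Proof. by []. Qed.
Lemma C0_oppE f x : (- f) x = - f x. Proof. by []. Qed.
Lemma C0_scaleE (c : C) f x : (c *: f) x = c * f x. Proof. by []. Qed.
Definition C0E := (C0_mulE, C0_pullE, C0_conjE, C0_addE, C0_oppE, C0_scaleE).

Lemma C0_mulC f g : C0_mul f g = C0_mul g f.
Proof. by apply: C0_ext => x; rewrite !C0E mulrC. Qed.

Definition supbound f (M : R) := forall x, `|f x| <= rc M.

(** Urysohn's lemma in the one-point compactification, separating K from the
    point at infinity; vanishing at infinity is continuity at that point. *)
Lemma locally_compact_cutoff (K : set X) :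
  locally_compact [set: X] -> hausdorff_space X -> compact K ->
  exists e : C0X, (forall x, 0 <= e x <= 1) /\ forall x, K x -> e x = 1.
Proof.
move=> lcX hX cK; pose Y := one_point_compactification X.
have hY : hausdorff_space Y by exact: one_point_compactification_hausdorff.
have nY : normal_space Y.
  by apply: compact_normal => //; exact: one_point_compactification_compact.
have cSK : closed (Some @` K : set Y).
  apply: compact_closed => //; apply: continuous_compact => //.
  apply: continuous_subspaceT.
  exact: (@one_point_compactification_some_continuous X).
have c0 : closed ([set None] : set Y).
  exact: accessible_closed_set1 (hausdorff_accessible hY) _.
have I0 : ([set None] : set Y) `&` Some @` K = set0.
  by rewrite -subset0 => y [/= -> [? _]].
have := (@normal_separatorP R Y).1 nY _ _ c0 cSK I0.
move=> /(@uniform_separatorP Y R)[f [fc f01 f0 f1]].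
have fx01 y : 0 <= f y <= 1.
  by have /= := f01 (f y) (ex_intro2 _ _ y I erefl); rewrite in_itv.
pose e x := rc (f (Some x)).
have ec : continuous e.
  move=> x; apply: (@continuous_comp _ _ _ (f \o Some) (@rc R)).
    by apply: (@continuous_comp _ Y); [exact: one_point_compactification_some_continuous|exact: fc].
  exact: rc_continuous.
have eC0 : e \in @C0_pred R X.
  apply/C0P; split=> // d d0.
  have D0 : 0 < complex.Re d by rewrite -ltr_rc -ge0_rc// ltW.
  have fN : f None = 0 by apply: f0; exists None.
  have := fc None; move/cvgrPdist_lt => /(_ _ D0) /=.
  case=> W [cW clW] WS; apply: (subclosed_compact _ cW).
    exact: norm_level_closed ec (gtr0_real d0).
  move=> x /= dx; apply: contrapT => nWx.
  have /= : `|f None - f (Some x)| < complex.Re d by apply: WS; left; exists x.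
  move: dx; rewrite /e norm_rc (ge0_rc (ltW d0)) ler_rc fN sub0r normrN.
  by move=> /le_lt_trans h /h; rewrite ltxx.
exists (MkC0 eC0); split=> [x|x Kx] /=.
  by rewrite rc_ge0 -(_ : rc 1 = 1)// ler_rc.
by rewrite /e (f1 (f (Some x)))//; exists (Some x) => //; exists x.
Qed.

(** Cutoff functions, directed by the compact sets on which they equal 1. *)
Definition approx_unit : set_system C0X := filter_from compact (fun K : set X =>
  [set e : C0X | (forall x, 0 <= e x <= 1) /\ forall x, K x -> e x = 1]).

Lemma approx_unit_filter : Filter approx_unit.
Proof.
apply: filter_from_filter => [|K L cK cL]; first by exists set0; exact: compact0.
exists (K `|` L); first exact: compactU.
by move=> e [e01 eKL]; split; split=> // x xK; apply: eKL; [left|right].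
Qed.

Lemma approx_unit_proper : locally_compact [set: X] -> hausdorff_space X ->
  ProperFilter approx_unit.
Proof.
move=> lcX hX; have FF := approx_unit_filter.
by apply: filter_from_proper => // K; exact: locally_compact_cutoff.
Qed.

Lemma approx_unit_bound : \forall e \near approx_unit, supbound e 1.
Proof.
exists set0; first exact: compact0.
by move=> e [e01 _] x; have /andP[e0 e1] := e01 x; rewrite ger0_norm.
Qed.

Lemma approx_unit_pointwise (e z : C) (c : R) : 0 <= e <= 1 -> 0 < c ->
  (rc c <= `|z| -> e = 1) -> `|e * z - z| <= rc c.
Proof.
move=> /andP[e0 e1] c0 h; have [/h ->|] := boolP (rc c <= `|z|).
  by rewrite mul1r subrr normr0 rc_ge0 ltW.
have cr : rc c \is Num.real by rewrite ger0_real// rc_ge0 ltW.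
rewrite -real_ltNge// => zc.
rewrite -[X in _ - X]mul1r -mulrBl normrM (le_trans _ (ltW zc))//.
by rewrite ler_piMl// distrC ger0_norm ?subr_ge0// gerBl.
Qed.

(** Multiplying f by e o t changes it by at most c once e = 1 on the image under
    t of the compact set where |f| >= c. *)
Lemma approx_unit_pull (t : continuousType X X) f (c : R) : 0 < c ->
  \forall e \near approx_unit, supbound (C0_pull t e f - f) c.
Proof.
move=> c0; have /C0P[_ fv] := C0_valP f.
have C0' : 0 < rc c by rewrite rc_gt0.
exists (t @` [set x | rc c <= `|f x|]).
  apply: continuous_compact; last exact: fv.
  by apply: continuous_subspaceT => x; exact: cts_fun.
move=> e [e01 eK] x; rewrite !C0E.
by apply: approx_unit_pointwise => // fx; apply: eK; exists x.
Qed.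

Lemma approx_unit_mul f (c : R) : 0 < c ->
  \forall e \near approx_unit, supbound (C0_mul e f - f) c.
Proof.
move=> c0; have /C0P[_ fv] := C0_valP f.
have C0' : 0 < rc c by rewrite rc_gt0.
exists [set x | rc c <= `|f x|]; first exact: fv.
move=> e [e01 eK] x; rewrite !C0E.
by apply: approx_unit_pointwise => // fx; apply: eK.
Qed.

Lemma C0_supbound f : exists2 M : R, 0 <= M & supbound f M.
Proof.
have [M M0 fM] := C0_bounded (C0_valP f).
exists (complex.Re M); first by rewrite -rc_ge0 -ge0_rc// ltW.
by move=> x; rewrite -ge0_rc// ltW.
Qed.

End C0Theory.

(** * *-representations of C_0(X) are contractive *)
Section StarRepresentations.
Variables (R : realType) (X : topologicalType) (H : hilbert R).
Local Notation C := (cplx R).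
Local Notation C0X := (C0 R X).
Local Notation dot := (hdot H).

Lemma hdotDl (x y z : H) : dot (x + y) z = dot x z + dot y z.
Proof. exact: linearDl. Qed.
Lemma hdotDr (x y z : H) : dot x (y + z) = dot x y + dot x z.
Proof. exact: linearDr. Qed.
Lemma hdotZl (c : C) (x y : H) : dot (c *: x) y = c * dot x y.
Proof. exact: linearZl_LR. Qed.
Lemma hdotZr (c : C) (x y : H) : dot x (c *: y) = c^* * dot x y.
Proof. exact: linearZr_LR. Qed.
Lemma hdotBl (x y z : H) : dot (x - y) z = dot x z - dot y z.
Proof. exact: linearBl. Qed.
Lemma hdotBr (x y z : H) : dot x (y - z) = dot x y - dot x z.
Proof. exact: linearBr. Qed.
Lemma hdotC (x y : H) : dot x y = (dot y x)^*.
Proof. by rewrite hermC expr0 mul1r. Qed.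

Lemma sqrtC_near (a b d : C) : 0 <= a -> 0 <= b -> 0 < d ->
  `|a - b| < d ^+ 2 -> `|sqrtC a - sqrtC b| < d.
Proof.
move=> a0 b0 d0 ab; rewrite -(@ltr_pXn2r _ 2) ?nnegrE//; last exact: ltW.
apply: le_lt_trans ab; rewrite -[a in leRHS]sqrtCK -[b in leRHS]sqrtCK.
rewrite subr_sqr normrM expr2 ler_wpM2l// ger0_norm ?addr_ge0 ?sqrtC_ge0//.
by rewrite (le_trans (ler_normB _ _))// !ger0_norm ?sqrtC_ge0.
Qed.

(** With s = sqrt (M^2 - |f|^2) the function g = M - s satisfies
    (M - g)^2 = M^2 - |f|^2, and it lies in C_0(X) although s need not, since
    (M + s) g = |f|^2 forces 0 <= g <= |f|. *)
Lemma contraction_defect (f : C0X) (M : R) : 0 < M -> supbound f M ->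
  exists g : C0X, [/\ C0_conj g = g &
    C0_mul g g = (rc M *+ 2) *: g - C0_mul (C0_conj f) f].
Proof.
move=> M0 fM; have M0' : 0 < rc M by rewrite rc_gt0.
have M0le := ltW M0'.
pose s x := sqrtC (rc M ^+ 2 - `|f x| ^+ 2).
pose g x := rc M - s x.
have /C0P[fc _] := C0_valP f.
have rad0 x : 0 <= rc M ^+ 2 - `|f x| ^+ 2.
  by rewrite subr_ge0 ler_pXn2r ?nnegrE.
have s0 x : 0 <= s x by rewrite sqrtC_ge0.
have nc : continuous (fun x => rc M ^+ 2 - `|f x| ^+ 2).
  move=> x; apply: cvgB; first exact: cvg_cst.
  by apply: (@cvgM _ _ _ _ _ _ _ `|f x|) => //; apply: cvg_norm; exact: fc.
have sc : continuous s.
  move=> x; apply/cvgrPdist_lt => e e0.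
  have E0 : 0 < e ^+ 2 by rewrite exprn_gt0.
  have := nc x; move/cvgrPdist_lt => /(_ _ E0); apply: filterS => y.
  exact: sqrtC_near.
have gc : continuous g by move=> x; apply: cvgB (sc x); exact: cvg_cst.
have sE x : s x ^+ 2 = rc M ^+ 2 - `|f x| ^+ 2 by rewrite sqrtCK.
have sM x : s x <= rc M.
  rewrite -(@ler_pXn2r _ 2) ?nnegrE ?s0// sE gerBl.
  by rewrite exprn_ge0.
have gE x : g x ^+ 2 = rc M *+ 2 * g x - `|f x| ^+ 2.
  have := sE x; rewrite /g; move: (s x) (rc M) `|f x| => a b c h.
  by rewrite sqrrB h; ring.
have gC0 : g \in @C0_pred R X.
  apply: (C0_domin gc (C0_valP f)); exists 1 => // x; rewrite mul1r.
  have g0 : 0 <= g x by rewrite subr_ge0.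
  rewrite ger0_norm// -(ler_pM2l M0').
  apply: (@le_trans _ _ (`|f x| ^+ 2)); last first.
    by rewrite expr2 ler_wpM2r.
  have -> : `|f x| ^+ 2 = (rc M + s x) * g x.
    by rewrite mulrC /g -subr_sqr sE subKr.
  by rewrite ler_wpM2r// lerDl.
exists (MkC0 gC0); split; apply: C0_ext => x; rewrite !C0E.
  by rewrite conj_Creal// ger0_real// subr_ge0.
by rewrite -expr2 /= gE [_^* * _]mulrC -normCK.
Qed.

Variable rho : C0X -> bop H.
Hypothesis rhoL : linear rho.
Hypothesis rhoM : forall f g, rho (C0_mul f g) = rho f * rho g.
Hypothesis rhoS : forall f x y, dot (rho f x) y = dot x (rho (C0_conj f) y).

(** M^2 |x|^2 - |rho f x|^2 = |M x - rho g x|^2 for the g of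
    [contraction_defect]. *)
Lemma star_rep_contractive_pos (f : C0X) (M : R) : 0 < M -> supbound f M ->
  opbound (rho f) M.
Proof.
move=> M0 fM x; have [g [gr gg]] := contraction_defect M0 fM.
have M0' : 0 < rc M by rewrite rc_gt0.
have M0le := ltW M0'.
have Mr : (rc M)^* = rc M by rewrite conj_Creal// ger0_real.
rewrite -ler_rc rcM -!nrmE -(@ler_pXn2r _ 2) ?nnegrE ?mulr_ge0 ?normr_ge0//.
rewrite exprMn !hilbert_normE -subr_ge0.
suff -> : rc M ^+ 2 * dot x x - dot (rho f x) (rho f x) =
    dot (rc M *: x - rho g x) (rc M *: x - rho g x).
  by rewrite -hilbert_normE exprn_ge0.
have grE y z : dot (rho g y) z = dot y (rho g z) by rewrite rhoS gr.
have ffE : dot (rho f x) (rho f x) = dot x (rho (C0_mul (C0_conj f) f) x).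
  by rewrite rhoM bopME rhoS.
have gxx : dot (rho g x) (rho g x) =
   (rc M *+ 2) * dot x (rho g x) - dot (rho f x) (rho f x).
  rewrite grE -bopME -rhoM gg.
  have -> : rho (rc M *+ 2 *: g - C0_mul (C0_conj f) f) =
            rc M *+ 2 *: rho g - rho (C0_mul (C0_conj f) f).
    by rewrite (zmod_morphism_linear rhoL) (scalable_linear rhoL).
  rewrite bopBE bopZE hdotBr hdotZr ffE; congr (_ * _ - _).
  by rewrite conj_Creal// ger0_real// mulrn_wge0.
rewrite !hdotBl !hdotBr !hdotZl !hdotZr Mr gxx grE.
by ring.
Qed.

(** The case M = 0 is reached by letting the bound decrease to M. *)
Lemma star_rep_contractive (f : C0X) (M : R) : 0 <= M -> supbound f M ->
  opbound (rho f) M.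
Proof.
move=> M0 fM x; apply/ler_addgt0Pr => e e0.
have d0 : 0 < e / (nrm x + 1) by rewrite divr_gt0// ltr_wpDl ?nrm_ge0.
rewrite (le_trans (@star_rep_contractive_pos f (M + e / (nrm x + 1)) _ _ x))//.
- by rewrite ltr_wpDl.
- by move=> y; rewrite (le_trans (fM y))// ler_rc lerDl ltW.
- rewrite mulrDl lerD2l mulrAC ler_pdivrMr ?ltr_wpDl ?nrm_ge0//.
  by rewrite ler_wpM2l ?lerDl// ltW.
Qed.

End StarRepresentations.

(** * The relations of a semicrossed product *)
Section CovariantSystems.
Variables (R : realType) (X : topologicalType) (n : nat).
Variable tau : 'I_n -> continuousType X X.
Local Notation C := (cplx R).
Local Notation C0X := (C0 R X).

(** The relations and bounds satisfied by the generators of a semicrossed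
    product that survive completely contractive homomorphisms: neither adjoints
    nor nondegeneracy appear, and S_i f is an operator [s i f] that does not
    have to factor through f. *)
Record covariant_system (H : hilbert R) (u : C0X -> bop H)
    (s : 'I_n -> C0X -> bop H) : Prop := CovariantSystem {
  cs_uL : linear u;
  cs_uM : forall f g, u (C0_mul f g) = u f * u g;
  cs_uB : forall f (M : R), 0 <= M -> supbound f M -> opbound (u f) M;
  cs_sL : forall i, linear (s i);
  cs_sM : forall i f g, s i (C0_mul f g) = s i f * u g;
  cs_us : forall i f g, u f * s i g = s i (C0_pull (tau i) f g);
  cs_sB : forall i f (M : R), 0 <= M -> supbound f M -> opbound (s i f) M }.

Local Notation rep_s pi := (fun i f => cr_T pi i * cr_rho pi f).

Lemma rep_covariant (pi : covariant_rep R tau) :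
  covariant_system (cr_rho pi) (rep_s pi).
Proof.
have uB f (M : R) : 0 <= M -> supbound f M -> opbound (cr_rho pi f) M.
  apply: star_rep_contractive => //; [|exact: cr_rhoM|exact: cr_rho_star].
  by move=> c g h; rewrite linearP.
split=> //; first by move=> c f g; rewrite linearP.
- by move=> f g; rewrite cr_rhoM.
- move=> i c f g; rewrite linearP mulrDr; congr (_ + _).
  by apply: bop_ext => x; rewrite bopZE !bopME bopZE bopZ.
- by move=> i f g; rewrite cr_rhoM mulrA.
- by move=> i f g; rewrite mulrA cr_covariance.
- move=> i f M M0 fM; rewrite -[M]mul1r; apply: opboundM => //; last exact: uB.
  by apply: (proj1 (opnormP _ ler01)); exact: cr_contraction.
Qed.

Section Universal.
Variables (A : opalg R) (u : C0X -> bop (opalg_space A)).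
Variable s : 'I_n -> C0X -> bop (opalg_space A).
Hypothesis hA : is_semicrossed tau u s.

Lemma semicrossed_opbound p (M : R) : 0 <= M ->
  (forall pi : covariant_rep R tau,
    opbound (scpoly_eval (cr_rho pi) (rep_s pi) p) M) ->
  opbound (scpoly_eval u s p) M.
Proof.
move=> M0 h; apply/mxbound1/(mxnormP _ M0); rewrite (hA.2 1%N (fun _ _ => p)).
by apply: ge_ereal_sup => _ [pi ->]; apply/(mxnormP _ M0)/mxbound1.
Qed.

(** An identity between polynomials that holds in every covariant
    representation bounds the norm of the difference by every positive number. *)
Lemma semicrossed_eq p q : (forall pi : covariant_rep R tau,
    scpoly_eval (cr_rho pi) (rep_s pi) p = scpoly_eval (cr_rho pi) (rep_s pi) q) ->
  scpoly_eval u s p = scpoly_eval u s q.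
Proof.
move=> h; apply: opbound_eq => e /ltW e0.
have := @semicrossed_opbound (SCadd p (SCscale (-1) q)) e e0.
rewrite /= scaleN1r; apply => pi; rewrite h scaleN1r subrr => x.
by rewrite bop0E nrm0 mulr_ge0 ?nrm_ge0.
Qed.

Lemma semicrossed_covariant : covariant_system u s.
Proof.
split.
- move=> c f g; apply: (semicrossed_eq
    (p := SCfun n (c *: f + g)) (q := SCadd (SCscale c (SCfun n f)) (SCfun n g))).
  by move=> pi; exact: cs_uL (rep_covariant pi) _ _ _.
- move=> f g; apply: (semicrossed_eq
    (p := SCfun n (C0_mul f g)) (q := SCmul (SCfun n f) (SCfun n g))).
  by move=> pi; exact: cs_uM (rep_covariant pi) _ _.
- move=> f M M0 fM; apply: (semicrossed_opbound (p := SCfun n f)) => // pi.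
  exact: (cs_uB (rep_covariant pi)).
- move=> i c f g; apply: (semicrossed_eq
    (p := SCgen i (c *: f + g)) (q := SCadd (SCscale c (SCgen i f)) (SCgen i g))).
  by move=> pi; exact: cs_sL (rep_covariant pi) _ _ _ _.
- move=> i f g; apply: (semicrossed_eq
    (p := SCgen i (C0_mul f g)) (q := SCmul (SCgen i f) (SCfun n g))).
  by move=> pi; exact: cs_sM (rep_covariant pi) _ _ _.
- move=> i f g; apply: (semicrossed_eq
    (p := SCmul (SCfun n f) (SCgen i g)) (q := SCgen i (C0_pull (tau i) f g))).
  by move=> pi; exact: cs_us (rep_covariant pi) _ _ _.
- move=> i f M M0 fM; apply: (semicrossed_opbound (p := SCgen i f)) => // pi.
  exact: (cs_sB (rep_covariant pi)).
Qed.

End Universal.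
End CovariantSystems.

(** * Closed subspaces of Hilbert spaces *)
Section ClosedSubspace.
Variables (R : realType) (H : hilbert R).
Local Notation C := (cplx R).

Record closed_subspace := ClosedSubspace {
  csub_mem : {pred H};
  csub_submod : GRing.submod_closed csub_mem;
  csub_closed : closed [set x | x \in csub_mem] }.

HB.instance Definition _ (V : closed_subspace) :=
  GRing.isSubmodClosed.Build C H (csub_mem V) (csub_submod V).

Variable V : closed_subspace.

Record hsub := Hsub { hsub_val :> H; _ : hsub_val \in csub_mem V }.
HB.instance Definition _ := [isSub for hsub_val].
HB.instance Definition _ := [Choice of hsub by <:].
HB.instance Definition _ := [SubChoice_isSubLmodule of hsub by <:].

Implicit Types x y : hsub.

Lemma hsubP x : (x : H) \in csub_mem V. Proof. by case: x. Qed.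

Lemma hsub_normD x y : `|(x + y : hsub) : H| <= `|x : H| + `|y : H|.
Proof. exact: ler_normD. Qed.
Lemma hsub_normZ (l : C) x : `|(l *: x : hsub) : H| = `|l| * `|x : H|.
Proof. exact: normrZ. Qed.
Lemma hsub_norm0 x : `|x : H| = 0 -> x = 0.
Proof. by move/eqP; rewrite normr_eq0 => /eqP x0; exact: val_inj. Qed.

HB.instance Definition _ := Lmodule_isNormed.Build C hsub
  hsub_normD hsub_normZ hsub_norm0.

Lemma hsub_normE x : `|x| = `|x : H|. Proof. by []. Qed.

Lemma hsub_cvg I (F : set_system I) {FF : Filter F} (f : I -> hsub) x :
  (fun i => f i : H) @ F --> (x : H) -> f @ F --> x.
Proof.
by move=> /cvgrPdist_lt h; apply/cvgrPdist_lt => e /h.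
Qed.

Lemma hsub_complete (F : set_system hsub) :
  ProperFilter F -> cauchy F -> cvg F.
Proof.
move=> FF /cauchyP Fc.
have /cvg_ex[z Fz] : cvg (hsub_val @ F).
  apply: cvg_nrm_cauchy => e e0; have /Fc[x Fx] : 0 < rc e by rewrite rc_gt0.
  exists (x : H); apply: filterS Fx => y.
  by rewrite -ball_normE /= hsub_normE nrmE ltr_rc => /ltW.
have zV : z \in csub_mem V.
  apply: (@closed_cvg _ _ F _ hsub_val [set x : H | x \in csub_mem V]) Fz.
    exact: csub_closed.
  by apply: nearW => x; exact: hsubP.
apply/cvg_ex; exists (Hsub zV).
exact: (@hsub_cvg _ F _ id).
Qed.

HB.instance Definition _ := Uniform_isComplete.Build hsub hsub_complete.

Definition hsub_dot x y : C :=
  hdot H (hsub_val x) (hsub_val y).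

Lemma hsub_dot_bilinear :
  bilinear_for *%R (Num.conj \; *%R) hsub_dot.
Proof.
split=> [y c x z|x c y z]; first exact: linearPl.
exact: linearPr.
Qed.
HB.instance Definition _ := bilinear_isBilinear.Build C hsub hsub C
  *%R (Num.conj \; *%R) hsub_dot hsub_dot_bilinear.

Lemma hsub_dot_hermitian x y :
  hsub_dot x y = (-1) ^+ false * (hsub_dot y x)^*.
Proof. exact: hermC. Qed.
HB.instance Definition _ := isHermitianSesquilinear.Build C hsub false
  Num.conj hsub_dot hsub_dot_hermitian.

Lemma hsub_dot_gt0 x : x != 0 -> 0 < hsub_dot x x.
Proof. by move=> x0; rewrite /hsub_dot -hilbert_normE exprn_gt0// normr_gt0. Qed.
HB.instance Definition _ := isDotProduct.Build C hsub hsub_dot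
  hsub_dot_gt0.

Definition hsub_hilbert : hilbert R := @MkHilbert R hsub hsub_dot
  (fun x => hilbert_normE (x : H)).

End ClosedSubspace.

Section Restriction.
Variables (R : realType) (H : hilbert R) (V : closed_subspace H).
Local Notation HV := (hsub_hilbert V).

Section OneOperator.
Variable T : bop H.
Hypothesis TV : forall x : H, x \in csub_mem V -> T x \in csub_mem V.

Definition restr_fun (x : HV) : HV := Hsub (TV (hsubP (x : hsub V))).

Lemma restr_subproof : restr_fun \in @bop_pred R HV.
Proof.
have [M _ TM] := bop_bounded T.
apply: (@bop_mk R HV restr_fun M); last by move=> x; exact: TM.
by move=> c x y; apply: val_inj => /=; rewrite bopZD.
Qed.
Definition restr : bop HV := MkBop restr_subproof.

End OneOperator.
End Restriction.

(** * The covariant representation on the essential subspace *)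
Section Essential.
Variables (R : realType) (X : topologicalType) (n : nat).
Variable tau : 'I_n -> continuousType X X.
Hypotheses (lcX : locally_compact [set: X]) (hX : hausdorff_space X).
Local Notation C := (cplx R).
Local Notation C0X := (C0 R X).
Variables (K : hilbert R) (u : C0X -> bop K) (s : 'I_n -> C0X -> bop K).
Hypothesis hus : covariant_system tau u s.
Local Notation F := (@approx_unit R X).

Let FF : ProperFilter F := @approx_unit_proper R X lcX hX.
#[local] Existing Instance FF.

(** Common source of the convergences below: contractive linear dependence on f
    turns uniform convergence of functions into strong convergence. *)
Lemma near_unit_cvg (v : C0X -> bop K) (phi : C0X -> C0X) (f : C0X) (y : K) :
  linear v ->
  (forall g (M : R), 0 <= M -> supbound g M -> opbound (v g) M) ->
  (forall c : R, 0 < c -> \forall e \near F, supbound (phi e - f) c) ->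
  (fun e => v (phi e) y) @ F --> v f y.
Proof.
move=> vL vB phif; apply/cvg_nrmP => c c0.
have d0 : 0 < c / (nrm y + 1) by rewrite divr_gt0// ltr_wpDl ?nrm_ge0.
apply: filterS (phif _ d0) => e ef; rewrite nrmB -bopBE.
rewrite -(zmod_morphism_linear vL) (le_trans (vB _ _ (ltW d0) ef y))//.
rewrite mulrAC ler_pdivrMr ?ltr_wpDl ?nrm_ge0//.
by rewrite ler_wpM2l ?lerDl// ltW.
Qed.

Lemma unit_uu f y : (fun e => u e (u f y)) @ F --> u f y.
Proof.
rewrite (_ : (fun _ => _) = fun e => u (C0_mul e f) y); last first.
  by apply/funext => e; rewrite (cs_uM hus).
apply: near_unit_cvg; [exact: cs_uL hus|exact: cs_uB hus|].
exact: approx_unit_mul.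
Qed.

Lemma uu_unit f y : (fun e => u f (u e y)) @ F --> u f y.
Proof.
rewrite (_ : (fun _ => _) = fun e => u (C0_mul e f) y); last first.
  by apply/funext => e; rewrite C0_mulC (cs_uM hus).
apply: near_unit_cvg; [exact: cs_uL hus|exact: cs_uB hus|].
exact: approx_unit_mul.
Qed.

Lemma unit_su i f y : (fun e => s i e (u f y)) @ F --> s i f y.
Proof.
rewrite (_ : (fun _ => _) = fun e => s i (C0_mul e f) y); last first.
  by apply/funext => e; rewrite (cs_sM hus).
apply: near_unit_cvg; [exact: cs_sL hus _|exact: cs_sB hus _|].
exact: approx_unit_mul.
Qed.

Lemma su_unit i f y : (fun e => s i f (u e y)) @ F --> s i f y.
Proof.
rewrite (_ : (fun _ => _) = fun e => s i (C0_mul e f) y); last first.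
  by apply/funext => e; rewrite C0_mulC (cs_sM hus).
apply: near_unit_cvg; [exact: cs_sL hus _|exact: cs_sB hus _|].
exact: approx_unit_mul.
Qed.

(** Here the function e enters as e o tau_i, by covariance; this is why s_i maps
    into the essential subspace. *)
Lemma unit_us i f y : (fun e => u e (s i f y)) @ F --> s i f y.
Proof.
rewrite (_ : (fun _ => _) = fun e => s i (C0_pull (tau i) e f) y); last first.
  by apply/funext => e; rewrite -(cs_us hus).
apply: near_unit_cvg; [exact: cs_sL hus _|exact: cs_sB hus _|].
exact: approx_unit_pull.
Qed.

(** The closure of u(C_0(X)) K, defined through the approximate unit so that its
    elements come with an approximation. *)
Definition ess_pred : {pred K} := fun y => `[< (fun e => u e y) @ F --> y >].

Lemma essP y : reflect ((fun e => u e y) @ F --> y) (y \in ess_pred).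
Proof. exact: asboolP. Qed.

Lemma ess_submod : GRing.submod_closed ess_pred.
Proof.
split=> [|a x y /essP hx /essP hy]; apply/essP.
  rewrite (_ : (fun _ => _) = fun=> 0); first exact: cvg_cst.
  by apply/funext => e; rewrite bop0.
rewrite (_ : (fun _ => _) = fun e => a *: u e x + u e y).
  by apply: cvgD hy; exact: cvgZl_tmp.
by apply/funext => e; rewrite bopZD.
Qed.

Lemma unit_u_bound : \forall e \near F, opbound (u e) 1.
Proof.
by apply: filterS (@approx_unit_bound R X) => e e1; exact: (cs_uB hus).
Qed.
Lemma unit_s_bound i : \forall e \near F, opbound (s i e) 1.
Proof.
by apply: filterS (@approx_unit_bound R X) => e e1; exact: (cs_sB hus).
Qed.

Lemma ess_closed : closed [set y | y \in ess_pred].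
Proof.
move=> z zcl; apply/essP/cvg_nrmP => c c0.
have c3 : 0 < c / 3 by rewrite divr_gt0.
have : nbhs z [set y | nrm (z - y) <= c / 3].
  exact: (proj1 (cvg_nrmP (F := nbhs z) id z) (@cvg_id _ (nbhs z)) _ c3).
move=> /zcl[y [/= /essP/cvg_nrmP/(_ _ c3) hy zy]].
apply: filterS2 hy unit_u_bound => e yey ue1.
have -> : z - u e z = (z - y) + (y - u e y) + u e (y - z).
  by rewrite bopB -[RHS]addrA [X in _ = _ + X]addrA subrK addrA subrK.
have -> : c = c / 3 + c / 3 + c / 3 by field.
rewrite (le_trans (nrmD _ _))// lerD//; last first.
  by rewrite (le_trans (ue1 _))// mul1r nrmB.
by rewrite (le_trans (nrmD _ _))// lerD.
Qed.

Definition ess : closed_subspace K := ClosedSubspace ess_submod ess_closed.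
Local Notation H := (hsub_hilbert ess).

Lemma u_ess f y : u f y \in ess_pred.
Proof. by apply/essP; exact: unit_uu. Qed.
Lemma s_ess i f y : s i f y \in ess_pred.
Proof. by apply/essP; exact: unit_us. Qed.

Definition ess_u f : bop H := restr (V := ess) (fun y _ => u_ess f y).
Definition ess_s i f : bop H := restr (V := ess) (fun y _ => s_ess i f y).

Lemma ess_uL : linear ess_u.
Proof.
move=> c f g; apply: bop_ext => x; apply: val_inj => /=.
by rewrite (cs_uL hus).
Qed.

(** For y in the essential subspace pick d with u(d) y close to y; then s_i(e) y
    is close to s_i(e) u(d) y = s_i(e d) y, which tends to s_i(d) y. *)
Lemma ess_limit i : {T : bop H |
  (forall y, (fun e => ess_s i e y) @ F --> T y) & opbound T 1}.
Proof.
apply: cid2; apply: strong_limit.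
  by apply: filterS (unit_s_bound i) => e h y; exact: h.
move=> y; apply: cvg_nrm_cauchy => c c0.
have c2 : 0 < c / 2 by rewrite divr_gt0.
have /essP/cvg_nrmP/(_ _ c2)/filter_ex[d yd] := hsubP (y : hsub ess).
exists (ess_s i d y).
have /cvg_nrmP/(_ _ c2) := @unit_su i d (hsub_val y).
apply: filterS2 (unit_s_bound i) => e se1 h.
have -> : ess_s i d y - ess_s i e y =
  (ess_s i d y - ess_s i e (ess_u d y)) + ess_s i e (ess_u d y - y).
  by rewrite bopB addrA subrK.
rewrite [c]splitr (le_trans (nrmD _ _))// lerD//.
by rewrite (le_trans (se1 _))// mul1r nrmB.
Qed.

Definition ess_T i : bop H := s2val (ess_limit i).

Lemma ess_TuE i f : ess_T i * ess_u f = ess_s i f.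
Proof.
apply: bop_ext => y; rewrite bopME.
have h := s2valP (ess_limit i) (ess_u f y).
apply: (cvg_unique _ h) => //.
by apply: hsub_cvg; exact: unit_su.
Qed.

(** x + i t u(f) x is the limit of u(e + i t f e) x, and
    |e + i t f e| <= |1 + i t f|. *)
Lemma unit_rotation f (M t : R) (x : K) : C0_conj f = f -> 0 <= M -> supbound f M ->
  x \in ess_pred ->
  nrm (x + ('i * rc t) *: u f x) <= Num.sqrt (1 + t ^+ 2 * M ^+ 2) * nrm x.
Proof.
move=> fr M0 fM /essP xe.
have N0 : 0 <= 1 + t ^+ 2 * M ^+ 2 by rewrite addr_ge0// mulr_ge0// sqr_ge0.
apply: (@cvg_nrm_le _ _ _ F _ (fun e => u e x + ('i * rc t) *: u f (u e x))).
  by apply: cvgD => //; apply: cvgZl_tmp; exact: cvg_bop.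
apply: filterS (@approx_unit_bound R X) => e e1.
have -> : u e x + ('i * rc t) *: u f (u e x) =
    u (('i * rc t) *: C0_mul f e + e) x.
  by rewrite (cs_uL hus) bopDE bopZE (cs_uM hus) bopME addrC.
apply: (cs_uB hus); first exact: sqrtr_ge0.
move=> z; rewrite !C0E.
have -> : 'i * rc t * (f z * e z) + e z = (1 + 'i * rc t * f z) * e z by ring.
rewrite normrM; apply: (@le_trans _ _ (`|1 + 'i * rc t * f z| * 1)).
  by rewrite ler_wpM2l//; exact: e1.
rewrite mulr1 -(@ler_pXn2r _ 2) ?nnegrE ?normr_ge0 ?rc_ge0 ?sqrtr_ge0//.
have -> : rc (Num.sqrt (1 + t ^+ 2 * M ^+ 2)) ^+ 2 =
    1 + rc t ^+ 2 * rc M ^+ 2.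
  by rewrite expr2 -rcM -expr2 sqr_sqrtr// rcD !expr2 !rcM.
have fzr : (f z)^* = f z by rewrite -C0_conjE fr.
have tr : (rc t)^* = rc t by rewrite conj_Creal// complex_real.
rewrite normCK rmorphD !rmorphM /= conjCi fzr tr rmorph1.
have -> : (1 + 'i * rc t * f z) * (1 + - 'i * rc t * f z) =
   1 - 'i ^+ 2 * (rc t ^+ 2 * f z ^+ 2) by ring.
rewrite sqrCi mulN1r opprK lerD2l ler_wpM2l//.
  by rewrite expr2 -rcM rc_ge0 -expr2 sqr_ge0.
rewrite -real_normK; last by rewrite CrealE fzr.
have fzM := fM z; have M0' : 0 <= rc M by rewrite rc_ge0.
by apply: lerXn2r; rewrite ?nnegrE ?normr_ge0.
Qed.

(** In [unit_rotation] the squared left-hand side has linear coefficient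
    D = i (<u(f) x, x> - <x, u(f) x>), so that t D <= t^2 b for all real t. *)
Lemma ess_real_quadratic f x : C0_conj f = f -> x \in ess_pred ->
  hdot K (u f x) x = hdot K x (u f x).
Proof.
move=> fr xe; have [M M0 fM] := C0_supbound f.
set w := u f x; pose D := 'i * (hdot K w x - hdot K x w).
have Dr : D \is Num.real.
  rewrite CrealE /D rmorphM rmorphB /= conjCi -!hdotC mulNr -mulrN opprB.
  by [].
pose b := (M * nrm x) ^+ 2.
have dE : D = rc (complex.Re D) by rewrite /rc RRe_real.
have Db (t : R) : t * complex.Re D <= t ^+ 2 * b.
  rewrite -ler_rc /b !expr2 !rcM -dE.
  have tr : (rc t)^* = rc t by rewrite conj_Creal// complex_real.
  have := unit_rotation t fr M0 fM xe.
  rewrite -/w -(@ler_pXn2r _ 2) ?nnegrE ?nrm_ge0 ?mulr_ge0 ?sqrtr_ge0 ?nrm_ge0//.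
  rewrite exprMn sqr_sqrtr; last by rewrite addr_ge0// mulr_ge0// sqr_ge0.
  rewrite -ler_rc !expr2 !rcM -nrmE -expr2 hilbert_normE rcD !rcM -!nrmE.
  rewrite -[`|x| * `|x|]expr2 hilbert_normE.
  rewrite !hdotDl !hdotDr !hdotZl !hdotZr rmorphM /= conjCi tr => h.
  rewrite -subr_ge0.
  have -> : rc t * rc t * (rc M * `|x| * (rc M * `|x|)) - rc t * D =
    (rc 1 + rc t * rc t * (rc M * rc M)) * hdot K x x -
    (hdot K x x + - 'i * rc t * hdot K x w +
      ('i * rc t * hdot K w x + 'i * rc t * (- 'i * rc t * hdot K w w)))
    + rc t ^+ 2 * hdot K w w.
    rewrite -[hdot K x x]hilbert_normE /D -(_ : 1 = rc 1)//.
    have i2 : 'i * 'i = -1 :> C by rewrite -expr2 sqrCi.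
    ring: i2.
  apply: addr_ge0; first by rewrite subr_ge0.
  apply: mulr_ge0; last by rewrite -hilbert_normE exprn_ge0.
  by rewrite expr2 -rcM rc_ge0 -expr2 sqr_ge0.
have b0 : 0 <= b by rewrite sqr_ge0.
have D0 : complex.Re D = 0.
  have b1 : 0 < b + 1 by rewrite ltr_wpDl.
  (* b / (b + 1) < 1, so this t contradicts t D <= t^2 b unless D = 0 *)
  have := Db (complex.Re D / (b + 1)).
  set d := complex.Re D => h; apply/eqP; rewrite -sqrf_eq0 eq_le sqr_ge0 andbT.
  have : d ^+ 2 * (b + 1) <= d ^+ 2 * b.
    have c0 : 0 <= (b + 1) ^+ 2 by rewrite sqr_ge0.
    have := ler_wpM2l c0 h.
    have -> : (b + 1) ^+ 2 * (d / (b + 1) * d) = d ^+ 2 * (b + 1).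
      by field; rewrite gt_eqF.
    have -> // : (b + 1) ^+ 2 * ((d / (b + 1)) ^+ 2 * b) = d ^+ 2 * b.
      by field; rewrite gt_eqF.
  by rewrite mulrDr mulr1 gerDl.
have : D == 0 by rewrite dE D0.
by rewrite mulf_eq0 (negPf (neq0Ci _)) /= subr_eq0 => /eqP.
Qed.

(** Polarization: a sesquilinear form that vanishes on the diagonal is zero;
    tested on x + y and x + i y. *)
Lemma ess_real_symmetric f x y : C0_conj f = f -> x \in ess_pred ->
  y \in ess_pred -> hdot K (u f x) y = hdot K x (u f y).
Proof.
move=> fr xe ye; pose g a b := hdot K (u f a) b - hdot K a (u f b).
have g0 a : a \in ess_pred -> g a a = 0.
  by move=> ae; rewrite /g ess_real_quadratic ?subrr.
have gD c : g (x + c *: y) (x + c *: y) =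
    g x x + c * c^* * g y y + c^* * g x y + c * g y x.
  rewrite /g bopD bopZ !hdotDl !hdotDr !hdotZl !hdotZr; ring.
have xyE c : x + c *: y \in ess_pred.
  by rewrite addrC; have [_ h] := ess_submod; exact: h.
have h c : c^* * g x y + c * g y x = 0.
  by have := gD c; rewrite !g0// mulr0 !add0r.
have := h 1; rewrite rmorph1 !mul1r => /eqP; rewrite addr_eq0 => /eqP h1.
have := h 'i; rewrite conjCi h1 mulrNN -mulr2n => /eqP.
rewrite mulrn_eq0 /= mulf_eq0 (negPf (neq0Ci _)) /= => /eqP gyx.
by apply/eqP; rewrite -subr_eq0 -/(g x y) h1 gyx oppr0.
Qed.

(** The case of real functions suffices, since f = a + i b and its conjugate is
    a - i b with a and b real. *)
Lemma ess_star f (x y : H) :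
  hdot H (ess_u f x) y = hdot H x (ess_u (C0_conj f) y).
Proof.
rewrite /hdot /= /hsub_dot /=.
have xe := hsubP (x : hsub ess); have ye := hsubP (y : hsub ess).
move: (hsub_val x) (hsub_val y) xe ye => {}x {}y xe ye.
pose a : C0X := 2^-1 *: (f + C0_conj f).
pose b : C0X := (2^-1 * - 'i) *: (f - C0_conj f).
have ar : C0_conj a = a.
  apply: C0_ext => z; rewrite /a !C0E rmorphM rmorphD /= conjCK addrC.
  by rewrite conj_Creal// realV realn.
have br : C0_conj b = b.
  apply: C0_ext => z; rewrite /b !C0E !rmorphM rmorphB /= conjCK.
  by rewrite rmorphN /= conjCi opprK conj_Creal ?realV ?realn//; ring.
have fab : f = 'i *: b + a.
  apply: C0_ext => z; rewrite /a /b !C0E.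
  have -> : 'i * (2^-1 * - 'i * (f z - (f z)^*)) =
    - ('i ^+ 2) * (2^-1 * (f z - (f z)^*)) by ring.
  by rewrite sqrCi; field.
have fcab : C0_conj f = (- 'i) *: b + a.
  apply: C0_ext => z; rewrite /a /b !C0E.
  have -> : - 'i * (2^-1 * - 'i * (f z - (f z)^*)) =
    ('i ^+ 2) * (2^-1 * (f z - (f z)^*)) by ring.
  by rewrite sqrCi; field.
rewrite fcab {1}fab !(cs_uL hus) !bopDE !bopZE hdotDl hdotDr hdotZl hdotZr.
by rewrite !ess_real_symmetric// rmorphN /= conjCi opprK.
Qed.

Lemma ess_nondegenerate : dense [set y : H |
  exists m (f : 'I_m -> C0X) (x : 'I_m -> H), y = \sum_i ess_u (f i) (x i)].
Proof.
move=> O [y Oy] oO.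
have /essP ye := hsubP (y : hsub ess).
have hy : (fun e => ess_u e y) @ F --> y by exact: hsub_cvg.
have /filter_ex[e Oe] : \forall e \near F, O (ess_u e y).
  by apply: hy; exact: open_nbhs_nbhs.
exists (ess_u e y); split=> //; exists 1%N, (fun=> e), (fun=> y).
by rewrite big_ord1.
Qed.

Lemma ess_covariance f g i :
  ess_u f * ess_T i * ess_u g = ess_T i * ess_u (C0_pull (tau i) f g).
Proof.
rewrite -mulrA !ess_TuE; apply: bop_ext => y; apply: val_inj => /=.
by rewrite -(cs_us hus).
Qed.

Lemma ess_uM f g : ess_u (C0_mul f g) = ess_u f * ess_u g.
Proof.
by apply: bop_ext => y; apply: val_inj => /=; rewrite (cs_uM hus).
Qed.

Lemma ess_T_contraction i : (opnorm (ess_T i) <= 1)%E.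
Proof. apply/(opnormP _ ler01); exact: (s2valP' (ess_limit i)). Qed.

Definition ess_rho : {linear C0X -> bop H} :=
  HB.pack ess_u (GRing.isLinear.Build C C0X (bop H) *:%R ess_u ess_uL).

Definition ess_rep : covariant_rep R tau := @MkCovariantRep R X n tau H ess_rho
  ess_T ess_uM ess_star ess_nondegenerate ess_T_contraction ess_covariance.

Local Notation ev := (scpoly_eval u s).
Local Notation ev_rep :=
  (scpoly_eval (cr_rho ess_rep) (fun i f => cr_T ess_rep i * cr_rho ess_rep f)).

Lemma ess_eval p (y : H) : hsub_val (ev_rep p y) = ev p (hsub_val y).
Proof.
elim: p y => [f|i f|p hp q hq|c p hp|p hp q hq] y //=.
- by rewrite -[RHS]/(hsub_val (ess_s i f y)) -ess_TuE.
- by rewrite hp hq.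
- by rewrite hp.
- by rewrite hp hq.
Qed.

(** Polynomials have no constant term, so every monomial ends in some u(f) or
    s_i(f), which absorbs the approximate unit on its right. *)
Lemma eval_unit p (y : K) : (fun e => ev p (u e y)) @ F --> ev p y.
Proof.
elim: p y => [f|i f|p hp q hq|c p hp|p hp q hq] y /=.
- exact: uu_unit.
- exact: su_unit.
- exact: cvgD (hp y) (hq y).
- by apply: cvgZl_tmp; exact: hp.
- exact: cvg_bop (hq y).
Qed.

(** A bound on the essential subspace applies to the vectors u(e) x_j, and u(e)
    does not increase norms; let e run through the approximate unit. *)
Lemma ess_mxbound k (p : 'I_k -> 'I_k -> scpoly R X n) (M : R) : 0 <= M ->
  mxbound (\matrix_(i, j) ev_rep (p i j)) M ->
  mxbound (\matrix_(i, j) ev (p i j)) M.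
Proof.
move=> M0 hM x; apply/ler_addgt0Pr => c c0.
pose a := \matrix_(i, j) ev (p i j).
(* k coordinates share the error c; the 1 is there because k may be 0 *)
have k0 : 0 < k%:R + 1 :> R by rewrite ltr_wpDl.
have d0 : 0 < c / (k%:R + 1) by rewrite divr_gt0.
have near_i i : \forall e \near F,
    nrm (mxapp a x i - mxapp a (fun j => u e (x j)) i) <= c / (k%:R + 1).
  suff : (fun e => mxapp a (fun j => u e (x j)) i) @ F --> mxapp a x i.
    by move=> /cvg_nrmP; apply.
  rewrite /mxapp; apply: cvg_nrm_sum => j; rewrite mxE; exact: eval_unit.
have [e [ue1 he]] : exists e, opbound (u e) 1 /\ forall i,
    nrm (mxapp a x i - mxapp a (fun j => u e (x j)) i) <= c / (k%:R + 1).
  near F => e; exists e; split; first by near: e; exact: unit_u_bound.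
  by near: e; exact: filter_forall.
pose xe : 'I_k -> H := fun j => Hsub (V := ess) (u_ess e (x j)).
have := hM xe.
have -> : l2norm (mxapp (\matrix_(i, j) ev_rep (p i j)) xe) =
          l2norm (mxapp a (fun j => u e (x j))).
  congr (Num.sqrt _); apply: eq_bigr => i _; congr (complex.Re _ ^+ 2).
  rewrite hsub_normE; congr `|_|; rewrite /mxapp.
  elim/big_rec2: _ => // j y1 y2 _ <-; congr (_ + _).
  by rewrite !mxE; exact: ess_eval.
have -> : l2norm xe = l2norm (fun j => u e (x j)) by [].
move=> h; have le1 : l2norm (fun j => u e (x j)) <= l2norm x.
  rewrite -[leRHS]mul1r; apply: l2norm_le => // j; exact: ue1.
have -> : mxapp a x = fun i => (mxapp a x i - mxapp a (fun j => u e (x j)) i) +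
     mxapp a (fun j => u e (x j)) i.
  by apply/funext => i; rewrite subrK.
rewrite (le_trans (l2normD _ _))// addrC lerD//.
  by rewrite (le_trans h)// ler_wpM2l.
rewrite (le_trans (l2norm_sum _))//.
apply: (@le_trans _ _ (\sum_(i < k) c / (k%:R + 1))); first by apply: ler_sum.
rewrite sumr_const card_ord -[leLHS]mulr_natr mulrAC ler_pdivrMr//.
by rewrite ler_wpM2l ?lerDl// ltW.
Unshelve. all: by end_near. Qed.

End Essential.

(** Among all covariant representations, the one on the essential subspace
    already dominates. *)
Lemma covariant_system_dominated (R : realType) (X : topologicalType) (n : nat)
    (tau : 'I_n -> continuousType X X) (K : hilbert R) (u : C0 R X -> bop K)
    (s : 'I_n -> C0 R X -> bop K) :
  locally_compact [set: X] -> hausdorff_space X -> covariant_system tau u s ->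
  forall k (p : 'I_k -> 'I_k -> scpoly R X n),
    (mxnorm (\matrix_(i, j) scpoly_eval u s (p i j)) <=
     ereal_sup [set r | exists pi : covariant_rep R tau,
      r = mxnorm (\matrix_(i, j) scpoly_eval (cr_rho pi)
                    (fun l f => (cr_T pi l * cr_rho pi f)%R) (p i j))])%E.
Proof.
move=> lcX hX hus k p; set pi := ess_rep lcX hX hus.
apply: (@le_trans _ _ (mxnorm (\matrix_(i, j) scpoly_eval (cr_rho pi)
                    (fun l f => cr_T pi l * cr_rho pi f) (p i j)))).
  by apply/le_mxnorm => M M0; exact: ess_mxbound.
by apply: ereal_sup_ubound; exists pi.
Qed.

(** * Embedding the one-variable semicrossed products *)
Section Restrict.
Variables (R : realType) (X : topologicalType) (n : nat).
Local Notation C0X := (C0 R X).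

Fixpoint sc_rename (m : nat) (h : 'I_m -> 'I_n) (p : scpoly R X m) : scpoly R X n :=
  match p with
  | SCfun f => SCfun n f
  | SCgen i f => SCgen (h i) f
  | SCadd p q => SCadd (sc_rename h p) (sc_rename h q)
  | SCscale c p => SCscale c (sc_rename h p)
  | SCmul p q => SCmul (sc_rename h p) (sc_rename h q)
  end.

Lemma sc_renameE m (h : 'I_m -> 'I_n) (H : hilbert R) (u : C0X -> bop H) s p :
  scpoly_eval u s (sc_rename h p) = scpoly_eval u (fun i => s (h i)) p.
Proof. by elim: p => //= [p -> q ->|c p ->|p -> q ->]. Qed.

Variable tau : 'I_n -> continuousType X X.

Lemma zero_contraction (H : hilbert R) : (opnorm (0%R : bop H) <= 1)%E.
Proof. by apply/(opnormP _ ler01) => x; rewrite bop0E nrm0 mul1r nrm_ge0. Qed.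

Variable i : 'I_n.

Definition rep_restrict (pi : covariant_rep R tau) :
    covariant_rep R (fun _ : 'I_1 => tau i) :=
  @MkCovariantRep R X 1 (fun=> tau i) (cr_space pi) (cr_rho pi)
    (fun=> cr_T pi i) (@cr_rhoM _ _ _ _ pi) (@cr_rho_star _ _ _ _ pi)
    (@cr_nondegenerate _ _ _ _ pi) (fun=> @cr_contraction _ _ _ _ pi i)
    (fun f g _ => @cr_covariance _ _ _ _ pi f g i).

Section Extend.
Variable pi : covariant_rep R (fun _ : 'I_1 => tau i).

(** The zero operators satisfy every covariance relation, so a representation of
    one map extends to the whole system. *)
Definition extend_T (j : 'I_n) := if j == i then cr_T pi ord0 else 0.

Lemma extend_contraction j : (opnorm (extend_T j) <= 1)%E.
Proof.
rewrite /extend_T; case: ifP => _; first exact: cr_contraction.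
exact: zero_contraction.
Qed.

Lemma extend_covariance f g j :
  cr_rho pi f * extend_T j * cr_rho pi g =
  extend_T j * cr_rho pi (C0_pull (tau j) f g).
Proof.
rewrite /extend_T; case: eqVneq => [->|_]; first by rewrite (cr_covariance pi f g ord0).
by rewrite mulr0 !mul0r.
Qed.

Definition rep_extend : covariant_rep R tau :=
  @MkCovariantRep R X n tau (cr_space pi) (cr_rho pi) extend_T
    (@cr_rhoM _ _ _ _ pi) (@cr_rho_star _ _ _ _ pi)
    (@cr_nondegenerate _ _ _ _ pi) extend_contraction extend_covariance.
End Extend.

Variables (A : opalg R) (uA : C0X -> bop (opalg_space A)).
Variable sA : 'I_n -> C0X -> bop (opalg_space A).
Hypothesis hA : is_semicrossed tau uA sA.
Variables (B : opalg R) (uB : C0X -> bop (opalg_space B)).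
Variable sB : 'I_1 -> C0X -> bop (opalg_space B).
Hypothesis hB : is_semicrossed (fun _ : 'I_1 => tau i) uB sB.

(** Both norms are suprema over the same set of values: restriction and extension
    of representations leave the operators entering p unchanged. *)
Lemma restrict_mxnorm k (p : 'I_k -> 'I_k -> scpoly R X 1) :
  mxnorm (\matrix_(a, b) scpoly_eval uA (fun _ => sA i) (p a b)) =
  mxnorm (\matrix_(a, b) scpoly_eval uB sB (p a b)).
Proof.
rewrite hB.2.
have -> : \matrix_(a, b) scpoly_eval uA (fun=> sA i) (p a b) =
    \matrix_(a, b) scpoly_eval uA sA (sc_rename (fun=> i) (p a b)).
  by apply/matrixP => a b; rewrite !mxE sc_renameE.
rewrite hA.2; congr ereal_sup; apply/seteqP; split=> r [pi ->].
  exists (rep_restrict pi); congr mxnorm; apply/matrixP => a b.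
  by rewrite !mxE sc_renameE.
exists (rep_extend pi); congr mxnorm; apply/matrixP => a b.
rewrite !mxE sc_renameE /= /extend_T eqxx; congr scpoly_eval.
by apply/funext => j; rewrite (ord1 j).
Qed.

Lemma restrict_embedding : exists iota : bop (opalg_space B) -> bop (opalg_space A),
  [/\ is_ci_hom iota, forall f, iota (uB f) = uA f &
    forall f, iota (sB ord0 f) = sA i f].
Proof.
have [|f|j f|k p|iota [_ ie ici]] :=
    @extension R X 1 B A uB sB uA (fun _ => sA i).
- exact: hB.1.
- exact: gen_u hA.1 f.
- exact: gen_s hA.1 i f.
- by rewrite restrict_mxnorm.
exists iota; split; first by apply: ici => k p; rewrite restrict_mxnorm.
  by move=> f; exact: (ie (SCfun 1 f)).
by move=> f; exact: (ie (SCgen ord0 f)).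
Qed.
End Restrict.

(** * Free products *)
Section FreeProducts.
Variable R : realType.
Implicit Types A P Q S : opalg R.

Lemma ci_cc (A1 A2 : opalg R) (phi : bop (opalg_space A1) -> bop (opalg_space A2)) :
  is_ci_hom phi -> is_cc_hom phi.
Proof. by move=> [hphi ci]; split=> // k a Aa; rewrite ci. Qed.

Lemma id_cc_hom A : is_cc_hom (B := A) (id : bop (opalg_space A) -> _).
Proof.
by split=> // k a _; rewrite (_ : map_mx id a = a)//; apply/matrixP => i j; rewrite mxE.
Qed.

Lemma comp_cc_hom A P Q (phi : bop (opalg_space A) -> bop (opalg_space P))
    (psi : bop (opalg_space P) -> bop (opalg_space Q)) :
  is_cc_hom phi -> is_cc_hom psi -> is_cc_hom (psi \o phi).
Proof.
move=> [[phi0 phiL phiM] phin] [[psi0 psiL psiM] psin]; split; first split.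
- by move=> a /phi0/psi0.
- by move=> c a b Aa Ab /=; rewrite phiL// psiL//; exact: phi0.
- by move=> a b Aa Ab /=; rewrite phiM// psiM//; exact: phi0.
- move=> k a Aa; rewrite map_mx_comp; apply: le_trans (phin _ _ Aa).
  by apply: psin => i j; rewrite mxE; exact: phi0.
Qed.

(** The two universal maps compose to homomorphisms that fix the generators,
    hence to identities; two completely contractive maps inverse to each other
    are completely isometric. *)
Lemma free_product_iso (I D : Type) (A : I -> opalg R)
    (d : forall i, D -> bop (opalg_space (A i))) P Q
    (iotaP : forall i, bop (opalg_space (A i)) -> bop (opalg_space P))
    (iotaQ : forall i, bop (opalg_space (A i)) -> bop (opalg_space Q)) :
  is_free_product d iotaP -> is_free_product d iotaQ -> ci_isomorphic P Q.
Proof.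
move=> [ciP dP genP univP] [ciQ dQ genQ univQ].
have [phi [cphi phiE _]] := univP Q iotaQ (fun i => ci_cc (ciQ i)) dQ.
have [psi [cpsi psiE _]] := univQ P iotaP (fun i => ci_cc (ciP i)) dP.
have psiK b : opalg_set P b -> psi (phi b) = b.
  move=> Pb; apply: (cc_hom_unique genP (comp_cc_hom cphi cpsi) (id_cc_hom P)) => //.
  by move=> _ [i _ [a Aa <-]] /=; rewrite phiE// psiE.
have phiK b : opalg_set Q b -> phi (psi b) = b.
  move=> Qb; apply: (cc_hom_unique genQ (comp_cc_hom cpsi cphi) (id_cc_hom Q)) => //.
  by move=> _ [i _ [a Aa <-]] /=; rewrite psiE// phiE.
have [[[phi0 _ _] phin] [[psi0 _ _] psin]] := (cphi, cpsi).
exists phi; last first.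
  apply/seteqP; split=> [_ [a Pa <-]|b Qb]; first exact: phi0.
  by exists (psi b); [exact: psi0|exact: phiK].
split=> [|k a Pa]; first exact: cphi.1.
apply/le_anti/andP; split; first exact: phin.
have {1}-> : a = map_mx psi (map_mx phi a).
  by apply/matrixP => i j; rewrite !mxE psiK.
by apply: psin => i j; rewrite mxE; exact: phi0.
Qed.

End FreeProducts.

Section FreeProduct.
Variables (R : realType) (X : topologicalType).
Hypotheses (lcX : locally_compact [set: X]) (hX : hausdorff_space X).
Variables (n : nat) (tau : 'I_n -> continuousType X X).
Local Notation C0X := (C0 R X).
Hypothesis n_gt0 : (0 < n)%N.
Variables (A : opalg R) (uA : C0X -> bop (opalg_space A)).
Variable sA : 'I_n -> C0X -> bop (opalg_space A).
Hypothesis hA : is_semicrossed tau uA sA.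
Variable B : 'I_n -> opalg R.
Variable uB : forall i, C0X -> bop (opalg_space (B i)).
Variable sB : forall i, 'I_1 -> C0X -> bop (opalg_space (B i)).
Arguments uB : clear implicits.
Arguments sB : clear implicits.
Hypothesis hB : forall i, is_semicrossed (fun _ : 'I_1 => tau i) (uB i) (sB i).

(** The hypothesis that the [pi i] agree on C_0(X) lets each relation be checked
    inside a single algebra [B i]. *)
Lemma hom_covariant_system (S : opalg R)
    (pi : forall i, bop (opalg_space (B i)) -> bop (opalg_space S)) (i0 : 'I_n) :
  (forall i, is_cc_hom (pi i)) ->
  (forall i j x, pi i (uB i x) = pi j (uB j x)) ->
  covariant_system tau (fun f => pi i0 (uB i0 f)) (fun i f => pi i (sB i ord0 f)).
Proof.
move=> cpi upi; have cB i := semicrossed_covariant (hB i).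
have hpi i := (cpi i).1.
have Bu i f : opalg_set (B i) (uB i f) by exact: gen_u (hB i).1 f.
have Bs i f : opalg_set (B i) (sB i ord0 f) by exact: gen_s (hB i).1 ord0 f.
have linpi i (c : cplx R) a b : opalg_set (B i) a -> opalg_set (B i) b ->
    pi i (c *: a + b) = c *: pi i a + pi i b.
  by have [_ h _] := hpi i; exact: h.
split.
- by move=> c f g; rewrite (cs_uL (cB i0)) linpi.
- by move=> f g; rewrite (cs_uM (cB i0)) homM.
- move=> f M M0 fM; apply: cc_opbound => //; exact: (cs_uB (cB i0)).
- by move=> i c f g; rewrite (cs_sL (cB i)) linpi.
- by move=> i f g; rewrite (upi i0 i) (cs_sM (cB i)) homM.
- by move=> i f g; rewrite (upi i0 i) -(cs_us (cB i)) homM.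
- move=> i f M M0 fM; apply: cc_opbound => //; exact: (cs_sB (cB i)).
Qed.

Lemma hom_agree (S : opalg R) i (phi psi : bop (opalg_space (B i)) -> bop (opalg_space S)) :
  is_cc_hom phi -> is_cc_hom psi -> (forall f, phi (uB i f) = psi (uB i f)) ->
  (forall f, phi (sB i ord0 f) = psi (sB i ord0 f)) ->
  forall b, opalg_set (B i) b -> phi b = psi b.
Proof.
move=> cphi cpsi eu es; apply: cc_hom_unique (hB i).1 cphi cpsi _.
by move=> _ [[f _ <-]|[j _ [f _ <-]]] //; rewrite (ord1 j).
Qed.

(** The homomorphism out of A prescribed by a compatible family [pi] is given by
    [extension]: by [hom_covariant_system] the prescribed images form a covariant
    system, and such systems are dominated by the norm of A. *)
Lemma semicrossed_free_product :
  exists iota : forall i, bop (opalg_space (B i)) -> bop (opalg_space A),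
    is_free_product uB iota.
Proof.
have ex i := restrict_embedding hA (hB i).
pose iota i := projT1 (cid (ex i)).
have iotaP i : [/\ is_ci_hom (iota i), forall f, iota i (uB i f) = uA f &
    forall f, iota i (sB i ord0 f) = sA i f] by rewrite /iota; case: cid.
pose i0 : 'I_n := Ordinal n_gt0.
have ioB i b : opalg_set (B i) b -> opalg_set A (iota i b).
  by have [[[h _ _] _] _ _] := iotaP i; exact: h.
have Bu i f : opalg_set (B i) (uB i f) by exact: gen_u (hB i).1 f.
have Bs i f : opalg_set (B i) (sB i ord0 f) by exact: gen_s (hB i).1 ord0 f.
have genA : opalg_set A = smallest (@closed_subalgebra R _)
    (\bigcup_i (iota i @` opalg_set (B i))).
  apply/seteqP; split=> a; last first.
    by apply; split=> [|_ [i _ [b Bb <-]]]; [exact: opalgP|exact: ioB].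
  rewrite {1}hA.1 => h Y [Yc Yb]; apply: h; split=> // _ [[f _ <-]|[i _ [f _ <-]]].
    (* the functions lie in every B i; some index exists because n > 0 *)
    have [_ <- _] := iotaP i0; apply: Yb; exists i0 => //.
    by exists (uB i0 f).
  have [_ _ <-] := iotaP i; apply: Yb; exists i => //.
  by exists (sB i ord0 f).
exists iota; split=> //.
- by move=> i; have [] := iotaP i.
- by move=> i j f; have [_ -> _] := iotaP i; have [_ -> _] := iotaP j.
move=> S pi cpi upi.
have [|f|i f|k p|phi [cphi phiE _]] := @extension R X n A S uA sA
    (fun f => pi i0 (uB i0 f)) (fun i f => pi i (sB i ord0 f)).
- exact: hA.1.
- by have [[h _ _] _] := cpi i0; exact: h.
- by have [[h _ _] _] := cpi i; exact: h.
- rewrite hA.2; apply: covariant_system_dominated => //.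
  exact: hom_covariant_system.
have phiI i b : opalg_set (B i) b -> phi (iota i b) = pi i b.
  have [ci iu is_] := iotaP i.
  apply: (hom_agree (comp_cc_hom (ci_cc ci) cphi) (cpi i)) => f /=.
    by rewrite iu (phiE (SCfun n f)) (upi i i0).
  by rewrite is_ (phiE (SCgen i f)).
exists phi; split=> // psi cpsi psiI b Ab.
apply: (cc_hom_unique genA) => // _ [i _ [a Ba <-]].
by rewrite psiI// phiI.
Qed.

End FreeProduct.

Theorem theorem2 (R : realType) (X : topologicalType)
    (lcX : locally_compact [set: X]) (hX : hausdorff_space X)
    (n : nat) (n_gt0 : (0 < n)%N) (tau : 'I_n -> continuousType X X)
    (A : opalg R) (uA : C0 R X -> bop (opalg_space A))
    (sA : 'I_n -> C0 R X -> bop (opalg_space A))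
    (hA : is_semicrossed tau uA sA)
    (B : 'I_n -> opalg R)
    (uB : forall i, C0 R X -> bop (opalg_space (B i)))
    (sB : forall i, 'I_1 -> C0 R X -> bop (opalg_space (B i)))
    (hB : forall i, is_semicrossed (fun _ : 'I_1 => tau i) (uB i) (sB i)) :
  (exists (P : opalg R)
          (iota : forall i, bop (opalg_space (B i)) -> bop (opalg_space P)),
      is_free_product uB iota) /\
  (forall (P : opalg R)
          (iota : forall i, bop (opalg_space (B i)) -> bop (opalg_space P)),
      is_free_product uB iota -> ci_isomorphic A P).
Proof.
have [iota fpA] := semicrossed_free_product lcX hX n_gt0 hA hB.
split; first by exists A, iota; exact: fpA.
by move=> P iotaP; exact: (free_product_iso fpA).
Qed.
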